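(* Let $m,p\ge 1$, $q=m+p$, and $L\ge 0$ an integer. Let $Q_\Phi$ be a QDF with minimal coefficient matrix $\Phi\in\mathbb{S}^{(\deg(Q_\Phi)+1)q}$ and set $d:=\max\{\deg(Q_\Phi),L\}$. Let $\mathfrak{B}_\ast\in\mathfrak{L}^{\mathrm{cont}}_{m,p,L}$ and let the data $w_{[0,T-1]}\in\mathfrak{B}_\ast|_{[0,T-1]}$ be given with $T\ge d+1$. Put $H:=\mathcal{H}_{d+1}(w_{[0,T-1]})$. Then: (i) If $\operatorname{rank} H = n_{\min}+m(d+1)$ and there exists a positive semidefinite $\Psi\in\mathbb{S}^{qd}$ such that $$H^\top\left(\begin{bmatrix}\Psi&0\\0&0_{q,q}\end{bmatrix}-\begin{bmatrix}0_{q,q}&0\\0&\Psi\end{bmatrix}+\begin{bmatrix}\Phi&0\\0&0\end{bmatrix}\right)H\ge 0 \qquad ( * )$$ (where $\Phi$ is padded with zeros to size $(d+1)q$), then the data $w_{[0,T-1]}$ are informative for dissipativity with respect to $Q_\Phi$, and $Q_\Psi$ is a storage function for $(\mathfrak{B}_\ast,Q_\Phi)$. (ii) Assume in addition that $Q_\Phi$ is static, i.e. $\Phi\in\mathbb{S}^q$, partitioned as $\Phi=\begin{bmatrix}\Phi_{11}&\Phi_{12}\\\Phi_{21}&\Phi_{22}\end{bmatrix}$ with $\Phi_{11}\in\mathbb{S}^m$, $\Phi_{12}=\Phi_{21}^\top\in\mathbb{R}^{m\times p}$, $\Phi_{22}\in\mathbb{S}^p$, that $\Phi$ has inertia $(p,0,m)$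 and $\Phi_{22}\le 0$. Then the data $w_{[0,T-1]}$ are informative for dissipativity with respect to $Q_\Phi$ if and only if $\operatorname{rank}H=n_{\min}+m(L+1)$ and there exists a positive semidefinite $\Psi\in\mathbb{S}^{qL}$ satisfying $( * )$.
   Context: Time axis $\mathbb{Z}_+$. For $A\in\mathbb{R}^{n\times n},B\in\mathbb{R}^{n\times m},C\in\mathbb{R}^{p\times n},D\in\mathbb{R}^{p\times m}$ ($n\ge0$), the (input-output) behavior is $\mathfrak{B}=\{w=(u,y):\mathbb{Z}_+\to\mathbb{R}^{q}\mid \exists x:\mathbb{Z}_+\to\mathbb{R}^n,\ x(t+1)=Ax(t)+Bu(t),\ y(t)=Cx(t)+Du(t)\ \forall t\}$; $(A,B,C,D)$ is a state-space representation of $\mathfrak{B}$. $\mathfrak{L}_{m,p}$ is the set of all such behaviors. $n(\mathfrak{B})$ is the smallest state dimension among its representations. The observability matrix $\mathcal{O}_k$ stacks $C,CA,\dots,CA^{k-1}$ ($\mathcal{O}_0$ void); the lag $\ell(C,A)$ is the smallest $k\ge0$ with $\operatorname{rank}\mathcal{O}_k=\operatorname{rank}\mathcal{O}_{k+1}$, and $\ell(\mathfrak{B}):=\ell(C,A)$ for any representation. $\mathfrak{B}$ is controllable if for all $w_1,w_2\in\mathfrak{B}$ and $t_1\in\mathbb{Z}_+$ there are $w\in\mathfrak{B}$, $t_2\ge t_1$ with $w(t)=w_1(t)$ on $[0,t_1]$ and $w(t)=w_2(t-t_2)$ for $t\ge t_2$. $\mathfrak{L}^{\mathrm{cont}}_{m,p,L}$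 is the set of controllable $\mathfrak{B}\in\mathfrak{L}_{m,p}$ with $\ell(\mathfrak{B})\le L$. Restricted behavior: $\mathfrak{B}|_{[t_0,t_1]}=\{w_{[t_0,t_1]}\mid w\in\mathfrak{B}\}$, where $w_{[i,j]}=\operatorname{col}(w(i),\dots,w(j))$. $\Sigma:=\{\mathfrak{B}\in\mathfrak{L}_{m,p}\mid w_{[0,T-1]}\in\mathfrak{B}|_{[0,T-1]}\}$ and $n_{\min}:=\min\{n(\mathfrak{B})\mid\mathfrak{B}\in\Sigma\}$. $\mathcal{H}_k(w_{[0,T-1]})$ is the depth-$k$ block Hankel matrix whose $(i,j)$ block is $w(i+j)$, $i\in[0,k-1]$, $j\in[0,T-k]$. A QDF with coefficient matrix $\Psi\in\mathbb{S}^{(M+1)q}$ ($M\ge -1$; $M=-1$ means $\Psi$ is the void $0\times0$ matrix and $Q_\Psi=0$) is $Q_\Psi(w)(t)=w_{[t,t+M]}^\top\Psi w_{[t,t+M]}$. Its degree is the smallest $d'\ge-1$ such that all blocks $\Psi_{i,j}$ ($q\times q$) with $i>d'$ vanish; a coefficient matrix of size $(\deg+1)q$ is called minimal; the QDF is static if its degree is $0$. $\nabla\Psi:=\begin{bmatrix}0_{q,q}&0\\0&\Psi\end{bmatrix}-\begin{bmatrix}\Psi&0\\0&0_{q,q}\end{bmatrix}$, so $Q_{\nabla\Psi}(w)(t)=Q_\Psi(w)(t+1)-Q_\Psi(w)(t)$. $Q_{\Psi_1}\le Q_{\Psi_2}$ on $\mathfrak{B}$ means $Q_{\Psi_1}(w)(t)\le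 Q_{\Psi_2}(w)(t)$ for all $w\in\mathfrak{B}$, $t\in\mathbb{Z}_+$. A storage function for $(\mathfrak{B},Q_\Phi)$ is a QDF $Q_\Psi$ with $Q_\Psi\ge0$ on $\mathfrak{B}$ and $Q_{\nabla\Psi}\le Q_\Phi$ on $\mathfrak{B}$. The data are informative for dissipativity with respect to $Q_\Phi$ if there exists a positive semidefinite $\Psi\in\mathbb{S}^{qd}$, $d=\max\{\deg(Q_\Phi),L\}$, with $Q_{\nabla\Psi}\le Q_\Phi$ on $\mathfrak{B}$ for all $\mathfrak{B}\in\Sigma\cap\mathfrak{L}^{\mathrm{cont}}_{m,p,L}$. Inertia $(a,b,c)$ means $a$ negative, $b$ zero, $c$ positive eigenvalues. *)

(* Defs.v *)
From HB Require Import structures.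
From mathcomp Require Import all_boot all_order all_algebra.
From mathcomp Require Import reals.
Set Implicit Arguments. Unset Strict Implicit. Unset Printing Implicit Defensive.
Import Order.TTheory GRing.Theory Num.Theory.
Local Open Scope ring_scope.

Section Defs.
Variable R : realType.

(* Entry (i,j) of M with nat indices, 0 outside the range (used for zero padding
   and for block/stacked indexing). *)
Definition mxget n1 n2 (M : 'M[R]_(n1, n2)) (i j : nat) : R :=
  match (insub i : option 'I_n1), (insub j : option 'I_n2) with
  | Some i', Some j' => M i' j'
  | _, _ => 0
  end.

(* trajectories w = (u,y) : Z_+ -> R^(m+p), u = first m components *)
Definition traj (m p : nat) := nat -> 'cV[R]_(m + p).
Definition behavior (m p : nat) := traj m p -> Prop.

Definition ss_behavior m p n (A : 'M[R]_n) (B : 'M[R]_(n, m)) (C : 'M[R]_(p, n))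
  (D : 'M[R]_(p, m)) : behavior m p :=
  fun w => exists x : nat -> 'cV[R]_n, forall t,
    x t.+1 = A *m x t + B *m usubmx (w t) /\
    dsubmx (w t) = C *m x t + D *m usubmx (w t).

Definition is_ss_rep m p (Bh : behavior m p) n (A : 'M[R]_n) (B : 'M[R]_(n, m))
  (C : 'M[R]_(p, n)) (D : 'M[R]_(p, m)) : Prop :=
  forall w, Bh w <-> ss_behavior A B C D w.

Definition in_L m p (Bh : behavior m p) : Prop :=
  exists n (A : 'M[R]_n) (B : 'M[R]_(n, m)) (C : 'M[R]_(p, n)) (D : 'M[R]_(p, m)),
    is_ss_rep Bh A B C D.

Definition is_state_dim m p (Bh : behavior m p) (k : nat) : Prop :=
  (exists (A : 'M[R]_k) (B : 'M[R]_(k, m)) (C : 'M[R]_(p, k)) (D : 'M[R]_(p, m)),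
      is_ss_rep Bh A B C D) /\
  (forall n (A : 'M[R]_n) (B : 'M[R]_(n, m)) (C : 'M[R]_(p, n)) (D : 'M[R]_(p, m)),
      is_ss_rep Bh A B C D -> (k <= n)%N).

(* observability matrix O_k = col(C, CA, ..., CA^(k-1)) *)
Definition obsv p n (k : nat) (C : 'M[R]_(p, n)) (A : 'M[R]_n) : 'M[R]_(k * p, n) :=
  \matrix_(r < k * p, j < n) mxget (C *m A ^+ (r %/ p)) (r %% p) j.

Definition is_lag p n (C : 'M[R]_(p, n)) (A : 'M[R]_n) (k : nat) : Prop :=
  \rank (obsv k C A) = \rank (obsv k.+1 C A) /\
  (forall k', (k' < k)%N -> \rank (obsv k' C A) <> \rank (obsv k'.+1 C A)).

Definition lag_le m p (Bh : behavior m p) (L : nat) : Prop :=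
  exists n (A : 'M[R]_n) (B : 'M[R]_(n, m)) (C : 'M[R]_(p, n)) (D : 'M[R]_(p, m)) k,
    is_ss_rep Bh A B C D /\ is_lag C A k /\ (k <= L)%N.

Definition controllable m p (Bh : behavior m p) : Prop :=
  forall w1 w2, Bh w1 -> Bh w2 -> forall t1 : nat,
    exists w (t2 : nat), Bh w /\ (t1 <= t2)%N /\
      (forall t, (t <= t1)%N -> w t = w1 t) /\
      (forall t, (t2 <= t)%N -> w t = w2 (t - t2)%N).

Definition in_Lcont m p (Bh : behavior m p) (L : nat) : Prop :=
  in_L Bh /\ controllable Bh /\ lag_le Bh L.

(* wd_[0,T-1] \in Bh|_[0,T-1]  (only wd 0, ..., wd (T-1) matter) *)
Definition in_restr m p (Bh : behavior m p) (T : nat) (wd : traj m p) : Prop :=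
  exists w, Bh w /\ forall t, (t < T)%N -> w t = wd t.

Definition in_Sigma m p (T : nat) (wd : traj m p) (Bh : behavior m p) : Prop :=
  in_L Bh /\ in_restr Bh T wd.

Definition is_nmin m p (T : nat) (wd : traj m p) (k : nat) : Prop :=
  (exists Bh, in_Sigma T wd Bh /\ is_state_dim Bh k) /\
  (forall Bh k', in_Sigma T wd Bh -> is_state_dim Bh k' -> (k <= k')%N).

(* w_[t, t+N-1] as a stacked column vector *)
Definition win m p (w : traj m p) (t N : nat) : 'cV[R]_(N * (m + p)) :=
  \col_(r < N * (m + p)) mxget (w (t + r %/ (m + p))%N) (r %% (m + p)) 0.

(* Q_Psi(w)(t) for Psi of size N q  (N = M+1 blocks; N = 0 is the void QDF) *)
Definition qdf m p N (Psi : 'M[R]_(N * (m + p))) (w : traj m p) (t : nat) : R :=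
  ((win w t N)^T *m Psi *m win w t N) 0 0.

Definition padTL n (K : nat) (M : 'M[R]_n) : 'M[R]_K :=
  \matrix_(i < K, j < K) mxget M i j.
Definition padBR n (K k : nat) (M : 'M[R]_n) : 'M[R]_K :=
  \matrix_(i < K, j < K)
    (if (k <= i)%N && (k <= j)%N then mxget M (i - k)%N (j - k)%N else 0).

Definition nabla m p N (Psi : 'M[R]_(N * (m + p))) : 'M[R]_(N.+1 * (m + p)) :=
  padBR (N.+1 * (m + p)) (m + p) Psi - padTL (N.+1 * (m + p)) Psi.

(* all blocks Psi_{i,j} with block-row index i >= k vanish  (i.e. deg <= k-1) *)
Definition blocks_vanish_from m p N (Psi : 'M[R]_(N * (m + p))) (k : nat) : Prop :=
  forall r s : 'I_(N * (m + p)), (k * (m + p) <= r)%N -> Psi r s = 0.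

(* Psi is a minimal coefficient matrix: size (deg+1) q *)
Definition qdf_minimal m p N (Psi : 'M[R]_(N * (m + p))) : Prop :=
  forall k, blocks_vanish_from Psi k -> (N <= k)%N.

(* d = max(deg Q_Phi, L) where deg Q_Phi = N - 1 (N = 0 means deg = -1) *)
Definition dmax (N L : nat) : nat := maxn N.-1 L.

Definition sym_mx n (M : 'M[R]_n) : Prop := M^T = M.
Definition psd n (M : 'M[R]_n) : Prop :=
  sym_mx M /\ forall v : 'cV[R]_n, 0 <= (v^T *m M *m v) 0 0.

Definition qdf_le_on m p (Bh : behavior m p) N1 N2
  (Psi1 : 'M[R]_(N1 * (m + p))) (Psi2 : 'M[R]_(N2 * (m + p))) : Prop :=
  forall w t, Bh w -> qdf Psi1 w t <= qdf Psi2 w t.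

Definition storage_function m p (Bh : behavior m p) N1 N2
  (Phi : 'M[R]_(N1 * (m + p))) (Psi : 'M[R]_(N2 * (m + p))) : Prop :=
  (forall w t, Bh w -> 0 <= qdf Psi w t) /\ qdf_le_on Bh (nabla Psi) Phi.

(* informativity for dissipativity w.r.t. Q_Phi (Phi minimal of size N q) *)
Definition informative m p (L T : nat) (wd : traj m p) N
  (Phi : 'M[R]_(N * (m + p))) : Prop :=
  exists Psi : 'M[R]_(dmax N L * (m + p)), psd Psi /\
    forall Bh, in_Sigma T wd Bh -> in_Lcont Bh L -> qdf_le_on Bh (nabla Psi) Phi.

Definition hankel m p (k T : nat) (wd : traj m p) : 'M[R]_(k * (m + p), T - k + 1) :=
  \matrix_(r < k * (m + p), j < T - k + 1)
    mxget (wd (r %/ (m + p) + j)%N) (r %% (m + p)) 0.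

Definition has_inertia n (M : 'M[R]_n) (a b c : nat) : Prop :=
  exists lam : 'I_n -> R,
    char_poly M = \prod_(i < n) ('X - (lam i)%:P) /\
    #|[set i | lam i < 0]| = a /\ #|[set i | lam i == 0]| = b /\
    #|[set i | 0 < lam i]| = c.

Definition blk22 m p N (Phi : 'M[R]_(N * (m + p))) : 'M[R]_p :=
  \matrix_(i < p, j < p) mxget Phi (m + i)%N (m + j)%N.

Definition lmi_mx m p N (d : nat) (Phi : 'M[R]_(N * (m + p)))
  (Psi : 'M[R]_(d * (m + p))) : 'M[R]_(d.+1 * (m + p)) :=
  padTL (d.+1 * (m + p)) Psi - padBR (d.+1 * (m + p)) (m + p) Psi
  + padTL (d.+1 * (m + p)) Phi.

End Defs.

(* Main.v *)
Require Import Defs.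
From HB Require Import structures.
From mathcomp Require Import all_boot all_order all_algebra.
From mathcomp Require Import reals.
From mathcomp Require Import boolp ring lra zify.
Import Order.TTheory GRing.Theory Num.Theory.
Local Open Scope ring_scope.
Set Implicit Arguments. Unset Strict Implicit. Unset Printing Implicit Defensive.

(* Part (i).  A model B0 of minimal dimension has B0|[0,d] of dimension at most
   n_min + m(d+1), so the rank condition forces B0|[0,d] = im H.  Any controllable
   model B of the data of lag <= d is determined by its windows of length d+1,
   hence contains B0; controllability (every trajectory of B can be patched after
   a zero past) then gives B = B0.  So all windows are combinations of data
   windows, and the LMI on im H is the dissipation inequality.

   Part (ii), necessity.  The point is that im H must be all of B*|[0,L].  If not,
   some functional r0 of (past window, current input) vanishes on the data but
   not on B*.  Write models as y(t) = Y w_[t-L,t-1] + D u(t), with the past window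
   as state.  First, one finds a reachable such model of the data: starting from
   one satisfied by B*, assign the modes of the unreachable quotient to distinct
   generic real values by terms invisible on B*, and excite them through a small
   multiple of r0.  Then adding eta r0 to this model, which leaves the data
   explained, produces a model passing through an arbitrary window x (up to
   an arbitrarily small change of x and of eta, which restores reachability).  A
   common storage matrix would thus give x^T M x >= 0 for all x, M being the
   matrix of the LMI; on constant windows this says Phi >= 0, contradicting the
   p >= 1 negative eigenvalues of Phi.  Hence rank H = dim B*|[0,L] = n + m(L+1) with n
   the state dimension of B*, and n_min <= n gives the rank condition. *)

(** * Reachability *)

Section Reachability.
Variable F : fieldType.

Lemma exprSmx (K : pzRingType) n (A : 'M[K]_n) j : A ^+ j.+1 = A *m A ^+ j.
Proof. exact: exprS. Qed.

Lemma exprSrmx (K : pzRingType) n (A : 'M[K]_n) j : A ^+ j.+1 = A ^+ j *m A.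
Proof. exact: exprSr. Qed.

(** The rows of [xi] are functionals vanishing on the reachable subspace, the span of the columns of
    all [A ^+ j *m B]. Reachability is used in this dual form throughout: only the zero functional
    is unreachable. *)
Definition unreach n m (A : 'M[F]_n) (B : 'M[F]_(n, m)) k (xi : 'M[F]_(k, n)) :=
  forall j, xi *m A ^+ j *m B = 0.

Definition reach n m (A : 'M[F]_n) (B : 'M[F]_(n, m)) :=
  forall xi : 'rV[F]_n, unreach A B xi -> xi = 0.

Lemma unreach_step n m (A : 'M[F]_n) (B : 'M[F]_(n, m)) k (xi : 'M[F]_(k, n)) :
  unreach A B xi -> unreach A B (xi *m A).
Proof. by move=> h j; rewrite -(mulmxA xi) -exprSmx. Qed.

Lemma unreach0 n m (A : 'M[F]_n) (B : 'M[F]_(n, m)) k (xi : 'M[F]_(k, n)) :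
  unreach A B xi -> xi *m B = 0.
Proof. by move=> /(_ 0%N); rewrite expr0 mulmx1. Qed.

Lemma unreachM n m (A : 'M[F]_n) (B : 'M[F]_(n, m)) k l (xi : 'M[F]_(k, n))
  (M : 'M[F]_(l, k)) : unreach A B xi -> unreach A B (M *m xi).
Proof. by move=> h j; rewrite -!mulmxA (mulmxA xi) h mulmx0. Qed.

Lemma unreachD n m (A : 'M[F]_n) (B : 'M[F]_(n, m)) k (xi zeta : 'M[F]_(k, n)) :
  unreach A B xi -> unreach A B zeta -> unreach A B (xi + zeta).
Proof. by move=> h1 h2 j; rewrite !mulmxDl h1 h2 addr0. Qed.

Lemma unreachZ n m (A : 'M[F]_n) (B : 'M[F]_(n, m)) k (xi : 'M[F]_(k, n)) c :
  unreach A B xi -> unreach A B (c *: xi).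
Proof. by move=> h j; rewrite -!scalemxAl h scaler0. Qed.

Lemma unreach_inv n m (A : 'M[F]_n) (B : 'M[F]_(n, m)) k (xi : 'M[F]_(k, n)) M :
  xi *m A = M *m xi -> xi *m B = 0 -> unreach A B xi.
Proof.
move=> hA hB j; suff [N ->] : exists N, xi *m A ^+ j = N *m xi.
  by rewrite -mulmxA hB mulmx0.
elim: j => [|j [N IH]]; first by exists 1%:M; rewrite expr0 mulmx1 mul1mx.
by exists (N *m M); rewrite exprSrmx mulmxA IH -!mulmxA hA.
Qed.

Lemma pow_intertwine n k (A : 'M[F]_n) (A2 : 'M[F]_k) (Q : 'M[F]_(n, k)) j :
  A *m Q = Q *m A2 -> A ^+ j *m Q = Q *m A2 ^+ j.
Proof.
move=> h; elim: j => [|j IH]; first by rewrite !expr0 mulmx1 mul1mx.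
by rewrite exprSrmx -mulmxA h mulmxA IH -mulmxA -exprSrmx.
Qed.

(** A right-invertible [Q] makes [(A, B)] a quotient of [(A2, B2)], and functionals pull back along
    [Q] injectively. *)
Lemma reach_conj n k m (A : 'M[F]_n) (B : 'M[F]_(n, m)) (A2 : 'M[F]_k)
  (B2 : 'M[F]_(k, m)) (Q : 'M[F]_(n, k)) (Q' : 'M[F]_(k, n)) :
  Q *m Q' = 1%:M -> A *m Q = Q *m A2 -> B = Q *m B2 ->
  reach A2 B2 -> reach A B.
Proof.
move=> hQ hA hB h xi hxi.
suff h0 : xi *m Q = 0 by rewrite -(mulmx1 xi) -hQ mulmxA h0 mul0mx.
apply: h => j.
by rewrite -(mulmxA xi) -(pow_intertwine j hA) mulmxA -(mulmxA _ Q) -hB.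
Qed.

(** By Cayley-Hamilton, [A ^+ j] is the remainder of ['X^j] modulo the characteristic polynomial
    evaluated at [A], hence a combination of the first [n] powers. *)
Lemma reach_fin n m (A : 'M[F]_n) (B : 'M[F]_(n, m)) (xi : 'rV[F]_n) :
  (forall j, (j < n)%N -> xi *m A ^+ j *m B = 0) -> unreach A B xi.
Proof.
case: n A B xi => [|n] A B xi h j.
  by rewrite (flatmx0 B) mulmx0.
have Emx : A ^+ j = horner_mx A ('X^j %% char_poly A).
  rewrite -[in LHS](horner_mx_X A) -rmorphXn [in LHS](@divp_eq F 'X^j (char_poly A)).
  by rewrite rmorphD rmorphM /= Cayley_Hamilton mulr0 add0r.
have sz : (size ('X^j %% char_poly A)%R <= n.+1)%N.
  rewrite -ltnS -(size_char_poly A) ltn_modp.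
  by rewrite -size_poly_eq0 size_char_poly.
rewrite Emx -(take_poly_id sz) /take_poly poly_def rmorph_sum mulmx_sumr mulmx_suml.
rewrite big1 // => i _; rewrite /= linearZ rmorphXn /= horner_mx_X -scalemxAr -scalemxAl.
by rewrite h ?scaler0.
Qed.

Lemma horner_map_mxC n m (A : 'M[F]_(n, m)) x :
  map_mx (horner_eval x) (map_mx polyC A) = A.
Proof. by apply/matrixP => i j; rewrite !mxE /= horner_evalE hornerC. Qed.

Lemma horner_map_mxZ n m (A : 'M[{poly F}]_(n, m)) p x :
  map_mx (horner_eval x) (p *: A) = p.[x] *: map_mx (horner_eval x) A.
Proof. by rewrite map_mxZ. Qed.

Lemma scaleX_eq0 n m (p : 'M[{poly F}]_(n, m)) : 'X *: p = 0 -> p = 0.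
Proof.
move=> h; apply/matrixP => i j; move/matrixP: h => /(_ i j); rewrite !mxE.
by move/eqP; rewrite mulf_eq0 polyX_eq0 => /eqP.
Qed.

(* The transfer row det(1 - mu A) (be + al (1/mu - A)^-1 B) is written in the
   reciprocal variable mu = 1 / s, so that evaluating at mu = 0 peels off one Markov
   parameter al A^j B at a time and no degree count is needed. *)
Lemma transfer_poly n m (A : 'M[F]_n) (B : 'M[F]_(n, m)) (al : 'rV[F]_n)
  (be : 'rV[F]_m) : ~ (be = 0 /\ unreach A B al) ->
  exists g : {poly F}, g != 0 /\ forall mu, g.[mu] != 0 ->
    [/\ mu != 0, \det (1%:M - mu *: A) != 0 &
      \det (1%:M - mu *: A) *: be + mu *: (al *m \adj (1%:M - mu *: A) *m B) != 0].
Proof.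
move=> h.
pose C k l := @map_mx F {poly F} polyC k l.
pose PA : 'M[{poly F}]_n := 1%:M - 'X *: C _ _ A.
pose rho := C _ _ al *m \adj PA.
pose tau := \det PA *: C _ _ be + 'X *: (rho *m C _ _ B).
have evPA x : map_mx (horner_eval x) PA = 1%:M - x *: A.
  by rewrite map_mxB map_mx1 horner_map_mxZ hornerX horner_map_mxC.
have evdet x : (\det PA).[x] = \det (1%:M - x *: A).
  by rewrite -evPA det_map_mx.
have evtau x : map_mx (horner_eval x) tau =
    \det (1%:M - x *: A) *: be + x *: (al *m \adj (1%:M - x *: A) *m B).
  by rewrite map_mxD !horner_map_mxZ evdet hornerX !map_mxM map_mx_adj evPA
       !horner_map_mxC.
have det0 : (\det PA).[0] = 1 by rewrite evdet scale0r subr0 det1.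
have tau0 : tau != 0.
  apply/eqP => tau0; apply: h.
  have be0 : be = 0.
    by have := evtau 0; rewrite tau0 map_mx0 !scale0r addr0 subr0 det1 scale1r.
  split=> // j.
  have rho0 : rho *m C _ _ B = 0.
    by apply: scaleX_eq0; move: tau0; rewrite /tau be0 /C map_mx0 scaler0 add0r.
  have rhoE : rho = \det PA *: C _ _ al + 'X *: (rho *m C _ _ A).
    have : rho *m PA = \det PA *: C _ _ al.
      by rewrite /rho -mulmxA mul_adj_mx mul_mx_scalar.
    by move=> <-; rewrite /PA mulmxBr mulmx1 -scalemxAr subrK.
  have step k : rho *m C _ _ (A ^+ k) *m C _ _ B = 0 ->
      al *m A ^+ k *m B = 0 /\ rho *m C _ _ (A ^+ k.+1) *m C _ _ B = 0.
    rewrite {1}rhoE !mulmxDl -!scalemxAl -(mulmxA rho) -[C _ _ A *m _](map_mxM polyC) -exprSmx.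
    move=> e.
    have e0 : al *m A ^+ k *m B = 0.
      have := congr1 (map_mx (horner_eval 0)) e.
      by rewrite map_mxD !horner_map_mxZ det0 hornerX scale0r addr0 scale1r
        map_mx0 !map_mxM !horner_map_mxC.
    split=> //; apply: scaleX_eq0.
    by move: e; rewrite -!(map_mxM polyC) e0 map_mx0 scaler0 add0r.
  have all k : rho *m C _ _ (A ^+ k) *m C _ _ B = 0.
    elim: k => [|k IH]; last exact: (step k IH).2.
    by rewrite expr0 /C map_mx1 mulmx1.
  exact: (step j (all j)).1.
have [i ti0] : exists i, tau 0 i != 0 by apply/rV0Pn.
exists ('X * \det PA * tau 0 i); split.
  rewrite !mulf_neq0 ?polyX_eq0 //; apply/eqP => e; move: det0.
  by rewrite e horner0 => /esym/eqP; rewrite oner_eq0.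
move=> mu; rewrite !hornerM hornerX evdet !mulf_eq0 !negb_or => /andP[/andP[-> ->] ht].
split=> //; rewrite -evtau; apply/rV0Pn; exists i.
by rewrite mxE.
Qed.
End Reachability.

(** * The reachability Gramian, generic parameters and steering *)

Section Gramian.
Variable F : realFieldType.

(** The coefficient ring is left general because the Gramian is also formed for matrices of
    polynomials, when a pair depends on a parameter. *)
Definition gram (K : comNzRingType) n m (A : 'M[K]_n) (B : 'M[K]_(n, m)) :=
  \sum_(j < n) (A ^+ j *m B) *m (A ^+ j *m B)^T.

Lemma row_dot_eq0 n (r : 'rV[F]_n) : (r *m r^T) 0 0 = 0 -> r = 0.
Proof.
rewrite mxE => /eqP; rewrite psumr_eq0 => [/allP h|i _]; last first.
  by rewrite mxE -expr2 sqr_ge0.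
apply/rowP => i; rewrite [RHS]mxE; have := h i (mem_index_enum i).
by rewrite /= mxE -expr2 sqrf_eq0 => /eqP.
Qed.

Lemma row_dot_ge0 n (r : 'rV[F]_n) : 0 <= (r *m r^T) 0 0.
Proof. by rewrite mxE sumr_ge0 // => i _; rewrite mxE -expr2 sqr_ge0. Qed.

(** [xi *m gram A B *m xi^T] is the sum of the squares of all entries of the rows
    [xi *m A ^+ j *m B], so over a real field it vanishes only if they all do. *)
Lemma unreach_gram n m (A : 'M[F]_n) (B : 'M[F]_(n, m)) (xi : 'rV[F]_n) :
  unreach A B xi <-> xi *m gram A B = 0.
Proof.
split=> [h|h].
  by rewrite mulmx_sumr big1 // => j _; rewrite !mulmxA h !mul0mx.
apply: reach_fin.
have : (xi *m gram A B *m xi^T) 0 0 = 0 by rewrite h mul0mx mxE.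
rewrite mulmx_sumr mulmx_suml summxE.
have E (j : 'I_n) : xi *m (A ^+ j *m B *m (A ^+ j *m B)^T) *m xi^T =
    (xi *m A ^+ j *m B) *m (xi *m A ^+ j *m B)^T.
  by rewrite -!mulmxA !trmx_mul !mulmxA.
move/eqP; rewrite psumr_eq0 => [/allP hj j jn|j _]; last first.
  by have := row_dot_ge0 (xi *m A ^+ j *m B); rewrite -E; exact.
apply: row_dot_eq0; have := hj (Ordinal jn) (mem_index_enum _).
by move/eqP => <-; exact: (congr1 (fun M : 'M[F]_1 => M 0 0) (esym (E (Ordinal jn)))).
Qed.

Lemma reach_gram n m (A : 'M[F]_n) (B : 'M[F]_(n, m)) :
  reach A B <-> \det (gram A B) != 0.
Proof.
split=> [h|h xi /unreach_gram].
  apply/eqP => /eqP /det0P [v v0 hv].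
  by case/eqP: v0; apply/h/unreach_gram.
have u : gram A B \in unitmx by rewrite unitmxE unitfE.
by move/(congr1 (mulmx^~ (invmx (gram A B)))); rewrite mulmxK // mul0mx.
Qed.

Lemma map_mxX_horner n (A : 'M[{poly F}]_n) x j :
  map_mx (horner_eval x) (A ^+ j) = map_mx (horner_eval x) A ^+ j.
Proof.
elim: j => [|j IH]; first by rewrite !expr0 map_mx1.
by rewrite !exprSmx map_mxM IH.
Qed.

(** The Gramian determinant of the perturbed pair is a polynomial in [x] that is nonzero at [x = 0];
    it serves as [g]. The quadratic term is there for the rescaled system of [block_perturb]. *)
Lemma reach_open n m (A0 A1 A2 : 'M[F]_n) (B0 B1 : 'M[F]_(n, m)) :
  reach A0 B0 -> exists g : {poly F}, g != 0 /\ forall x, g.[x] != 0 ->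
    reach (A0 + x *: A1 + x ^+ 2 *: A2) (B0 + x *: B1).
Proof.
move=> h0.
pose C k l := @map_mx F {poly F} polyC k l.
pose PA : 'M[{poly F}]_n := C _ _ A0 + 'X *: C _ _ A1 + 'X^2 *: C _ _ A2.
pose PB : 'M[{poly F}]_(n, m) := C _ _ B0 + 'X *: C _ _ B1.
have evA x : map_mx (horner_eval x) PA = A0 + x *: A1 + x ^+ 2 *: A2.
  by rewrite !map_mxD !horner_map_mxZ hornerXn hornerX !horner_map_mxC.
have evB x : map_mx (horner_eval x) PB = B0 + x *: B1.
  by rewrite !map_mxD !horner_map_mxZ hornerX !horner_map_mxC.
have evG x : (\det (gram PA PB)).[x] =
    \det (gram (A0 + x *: A1 + x ^+ 2 *: A2) (B0 + x *: B1)).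
  rewrite -horner_evalE -det_map_mx; congr (\det _).
  rewrite /gram map_mx_sum; apply: eq_bigr => j _.
  by rewrite map_mxM -map_trmx map_mxM map_mxX_horner evA evB.
exists (\det (gram PA PB)); split.
  apply/eqP => e; have := evG 0; rewrite e horner0 expr0n /= !scale0r !addr0.
  by move/esym/eqP; apply/negP/reach_gram.
by move=> x; rewrite evG => /reach_gram.
Qed.

Lemma poly_nonroot (g : {poly F}) (a b : F) : g != 0 -> a < b ->
  exists x, [/\ a < x, x < b & g.[x] != 0].
Proof.
move=> g0 ab; have ba0 : 0 < b - a by rewrite subr_gt0.
(* These are [size g] distinct points strictly between [a] and [b], more than [g] has roots. *)
pose s := [seq a + (b - a) / k.+2%:R | k <- iota 0 (size g)].
have us : uniq s.
  rewrite map_inj_uniq ?iota_uniq // => i j /addrI /(mulfI (lt0r_neq0 ba0)) /invr_inj /eqP.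
  by rewrite eqr_nat => /eqP [].
have : ~~ all (root g) s.
  by apply/negP => h; have := max_poly_roots g0 h us; rewrite size_map size_iota ltnn.
case/allPn => x /mapP [k _ ->] r; exists (a + (b - a) / k.+2%:R); split=> //.
  by rewrite ltrDl divr_gt0.
by rewrite -ltrBrDl ltr_pdivrMr // ltr_pMr // ltr1n.
Qed.

Fixpoint state n m (A : 'M[F]_n) (B : 'M[F]_(n, m)) (s : 'cV[F]_n)
  (u : nat -> 'cV[F]_m) (t : nat) : 'cV[F]_n :=
  if t is t'.+1 then A *m state A B s u t' + B *m u t' else s.

Lemma state_sum n m (A : 'M[F]_n) (B : 'M[F]_(n, m)) s u k :
  state A B s u k = A ^+ k *m s + \sum_(j < k) A ^+ j *m B *m u (k - j.+1)%N.
Proof.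
elim: k => [|k IH]; first by rewrite big_ord0 addr0 expr0 mul1mx.
rewrite [LHS]/= IH big_ord_recl /= expr0 mul1mx subn1 /= mulmxDr mulmxA -exprSmx.
rewrite -addrA; congr (_ + _); rewrite addrC; congr (_ + _).
by rewrite mulmx_sumr; apply: eq_bigr => j _; rewrite exprSmx !mulmxA subSS.
Qed.

Lemma steer n m (A : 'M[F]_n) (B : 'M[F]_(n, m)) s s' : reach A B ->
  exists u, state A B s u n = s'.
Proof.
move=> /reach_gram h.
have G : gram A B \in unitmx by rewrite unitmxE unitfE.
(* This is the minimum-energy input: the response to it is the Gramian applied to its inverse times
   the required displacement. *)
exists (fun i => (A ^+ (n - i.+1) *m B)^T *m (invmx (gram A B) *m (s' - A ^+ n *m s))).
rewrite state_sum.
under eq_bigr => j _ do rewrite subnSK ?ltn_ord // subKn ?(ltnW (ltn_ord _)) // mulmxA.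
by rewrite -mulmx_suml mulKVmx // addrC subrK.
Qed.

Lemma eq_state n m (A : 'M[F]_n) (B : 'M[F]_(n, m)) s u v k :
  (forall i, (i < k)%N -> u i = v i) -> state A B s u k = state A B s v k.
Proof.
elim: k => //= k IH h; rewrite (IH _) ?h // => i ik; apply: h.
exact: ltn_trans ik _.
Qed.

Lemma state_add n m (A : 'M[F]_n) (B : 'M[F]_(n, m)) s u a b :
  state A B s u (a + b) =
  state A B (state A B s u a) (fun i => u (a + i)%N) b.
Proof. by elim: b => [|b IH]; rewrite ?addn0 // addnS /= IH. Qed.

Lemma unreach_state n m (A : 'M[F]_n) (B : 'M[F]_(n, m)) k (xi : 'M[F]_(k, n)) u t :
  unreach A B xi -> xi *m state A B 0 u t = 0.
Proof.
move=> h; rewrite state_sum mulmx0 add0r mulmx_sumr big1 // => j _.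
by rewrite !mulmxA h mul0mx.
Qed.
End Gramian.

(** * Reachable perturbations *)

Section Perturbation.
Variable F : realFieldType.

Lemma unreach_intertwine n k m (A : 'M[F]_n) (B : 'M[F]_(n, m)) (A2 : 'M[F]_k)
  (B2 : 'M[F]_(k, m)) (P : 'M[F]_(k, n)) l (xi : 'M[F]_(l, k)) :
  P *m A = A2 *m P -> P *m B = B2 -> unreach A B (xi *m P) -> unreach A2 B2 xi.
Proof.
move=> hA hB h j.
have E i : P *m A ^+ i = A2 ^+ i *m P.
  elim: i => [|i IH]; first by rewrite !expr0 mulmx1 mul1mx.
  by rewrite exprSrmx mulmxA IH -mulmxA hA mulmxA -exprSrmx.
by rewrite -(h j) -hB -!mulmxA; congr (_ *m _); rewrite !mulmxA E.
Qed.

(* Multiplying an unreachable functional by the factors (At - d j), j <> k, leaves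
   only its k-th mode; the factor (At - d k) then annihilates that mode too. *)
Lemma cascade_reach nu f m (A : 'M[F]_nu) (B : 'M[F]_(nu, m)) (al : 'rV[F]_nu)
  (be : 'rV[F]_m) (b : 'cV[F]_f) (d : 'rV[F]_f) :
  reach A B -> injective (d 0) -> (forall k, b k 0 != 0) ->
  (forall k (psi : 'rV[F]_nu), psi *m A + al = d 0 k *: psi ->
     psi *m B + be <> 0) ->
  reach (block_mx A 0 (b *m al) (diag_mx d)) (col_mx B (b *m be)).
Proof.
move=> hAB hd hb hz.
set At := block_mx _ _ _ _; set Bt := col_mx _ _.
have only_l (xi : 'rV[F]_nu) : unreach At Bt (row_mx xi 0) -> xi = 0.
  move=> h; apply: hAB.
  apply: (@unreach_intertwine _ _ _ At Bt A B (row_mx 1%:M 0)).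
  - by rewrite mul_row_block mul_mx_row !mul1mx !mul0mx !addr0 mulmx1 mulmx0.
  - by rewrite mul_row_col mul1mx mul0mx addr0.
  - by rewrite mul_mx_row mulmx1 mulmx0.
have rsubA (xi : 'rV[F]_(nu + f)) i : (xi *m At) 0 (rshift nu i) = xi 0 (rshift nu i) * d 0 i.
  rewrite -[xi in LHS]hsubmxK mul_row_block mulmx0 add0r row_mxEr mul_mx_diag mxE.
  by rewrite [rsubmx xi _ _]mxE.
move=> xi hxi.
suff h0 : rsubmx xi = 0.
  by rewrite -(hsubmxK xi) h0 (only_l (lsubmx xi)) ?row_mx0 // -h0 hsubmxK.
apply/rowP => k; rewrite [RHS]mxE; apply/eqP; apply: contraT => hk.
have filt (s : seq 'I_f) : exists zeta : 'rV[F]_(nu + f), unreach At Bt zeta /\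
    forall i, zeta 0 (rshift nu i) = xi 0 (rshift nu i) * \prod_(j <- s) (d 0 i - d 0 j).
  elim: s => [|j s [zeta [hz1 hz2]]].
    by exists xi; split=> // i; rewrite big_nil mulr1.
  exists (zeta *m At - d 0 j *: zeta); split.
    by rewrite -scaleNr; apply: unreachD; [exact: unreach_step|exact: unreachZ].
  move=> i; rewrite mxE rsubA [X in _ + X]mxE [X in _ - X]mxE hz2 big_cons.
  by ring.
have [zeta [hz1 hz2]] := filt (filter (predC1 k) (enum 'I_f)).
pose c := zeta 0 (rshift nu k).
have c0 : c != 0.
  rewrite /c hz2 mulf_neq0 //; first by move: hk; rewrite mxE.
  rewrite prodf_seq_neq0; apply/allP => j; rewrite mem_filter /= => /andP[jk _].
  by rewrite subr_eq0; apply: contra jk => /eqP /hd ->.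
have zr : rsubmx zeta = c *: delta_mx 0 k.
  apply/rowP => i; rewrite !mxE eqxx /= /c.
  case: (eqVneq i k) => [->|ik]; first by rewrite mulr1.
  rewrite mulr0 hz2 (big_rem i) /= ?subrr ?mul0r ?mulr0 //.
  by rewrite mem_filter /= ik mem_enum.
pose zv := lsubmx zeta.
have zE : zeta = row_mx zv (c *: delta_mx 0 k) by rewrite -zr hsubmxK.
have db l (M : 'rV[F]_l) : c *: delta_mx 0 k *m (b *m M) = (c * b k 0) *: M.
  rewrite mulmxA -scalemxAl -rowE -scalemxAl -scalerA; congr (_ *: _).
  by rewrite (mx11_scalar (row k b)) mul_scalar_mx mxE.
have eB : zv *m B + (c * b k 0) *: be = 0.
  by have := unreach0 hz1; rewrite zE mul_row_col db.
have eA : zv *m A + (c * b k 0) *: al - d 0 k *: zv = 0.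
  apply: only_l.
  have -> : row_mx (zv *m A + (c * b k 0) *: al - d 0 k *: zv) 0 =
      zeta *m At - d 0 k *: zeta.
    rewrite zE mul_row_block db mulmx0 add0r scale_row_mx opp_row_mx add_row_mx.
    congr row_mx; apply/esym/eqP; rewrite subr_eq0; apply/eqP/rowP => i.
    rewrite mul_mx_diag !mxE eqxx /=; case: (eqVneq i k) => [->|_] /=; [by rewrite !mulr1 mulrC|by rewrite !mulr0 mul0r].
  by rewrite -scaleNr; apply: unreachD; [exact: unreach_step|exact: unreachZ].
have cb : c * b k 0 != 0 by rewrite mulf_neq0.
(* After division by [c * b k 0], the relations [eA] and [eB] exhibit [d 0 k] as a zero of the
   transfer row, which [hz] excludes. *)
case: (hz k ((c * b k 0)^-1 *: zv)).
  apply: (scalerI cb); rewrite scalerDr -scalemxAl !scalerA divff // scale1r.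
  by move/eqP: eA; rewrite subr_eq0 => /eqP ->; rewrite mulrAC divff // mul1r.
apply: (scalerI cb); rewrite scalerDr -scalemxAl !scalerA divff // scale1r.
by rewrite scaler0.
Qed.

(** Closed-loop eigenvectors are built one at a time as the columns of [X], with [G] the feedback
    values on them, and finally [K = G X^-1]. If [th] kills the columns found so far, reachability
    makes [th (s - A)^-1 E] a nonzero rational row, so for generic [s = 1 / mu] some
    [x = (1 - mu A)^-1 E e_i] has [th x <> 0] and is independent of them; it is an eigenvector for
    [s]. *)
Lemma pole_placement f p (A : 'M[F]_f) (E : 'M[F]_(f, p)) (g : {poly F}) :
  reach A E -> g != 0 ->
  exists (K : 'M[F]_(p, f)) (X : 'M[F]_f) (d : 'rV[F]_f),
    [/\ X \in unitmx, (A + E *m K) *m X = X *m diag_mx d, injective (d 0) &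
        forall i, d 0 i != 0 /\ g.[(d 0 i)^-1] != 0].
Proof.
move=> hAE g0.
have step k : (k <= f)%N -> exists (X : 'M[F]_(f, k)) (G : 'M[F]_(p, k)) (d : 'rV[F]_k),
    [/\ forall v : 'cV[F]_k, X *m v = 0 -> v = 0,
        A *m X + E *m G = X *m diag_mx d, injective (d 0) &
        forall i, d 0 i != 0 /\ g.[(d 0 i)^-1] != 0].
  elim: k => [_|k IH kf].
    exists 0, 0, 0; split=> [v _|||]; try by case.
      by apply/matrixP => -[].
    by apply/matrixP => i -[].
  have [X [G [d [Xinj XE dinj dg]]]] := IH (ltnW kf).
  have [th thX th0] : exists2 th : 'rV[F]_f, th *m X = 0 & th != 0.
    have : kermx X != 0.
      rewrite -mxrank_eq0 mxrank_ker subn_eq0 -ltnNge.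
      exact: leq_ltn_trans (rank_leq_col _) kf.
    by case/rowV0Pn => v /sub_kermxP h v0; exists v.
  have [g2 [g20 g2P]] : exists g2 : {poly F}, g2 != 0 /\ forall mu, g2.[mu] != 0 ->
    [/\ mu != 0, \det (1%:M - mu *: A) != 0 &
      \det (1%:M - mu *: A) *: (0 : 'rV[F]_p) + mu *: (th *m \adj (1%:M - mu *: A) *m E) != 0].
    by apply: transfer_poly => -[_ /hAE/eqP]; rewrite (negPf th0).
  (* The parameter [mu] must avoid the roots of [g], those of [g2], and the reciprocals of the
     eigenvalues already assigned. *)
  have g30 : g * g2 * \prod_i ('X - ((d 0 i)^-1)%:P) != 0.
    rewrite !mulf_neq0 //; apply/prodf_neq0 => i _; by rewrite polyXsubC_eq0.
  have [mu [_ _]] := poly_nonroot g30 (@ltr01 F).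
  rewrite !hornerM !mulf_eq0 !negb_or => /andP[/andP[gmu /g2P[mu0 det0 h]] hprod].
  have [i hi] : exists i, (th *m \adj (1%:M - mu *: A) *m E) 0 i != 0.
    apply/rV0Pn; apply: contra h => /eqP ->.
    by rewrite !scaler0 addr0.
  have U : 1%:M - mu *: A \in unitmx by rewrite unitmxE unitfE.
  pose dl : 'cV[F]_p := delta_mx i 0.
  have [x xdef] : exists x, x = invmx (1%:M - mu *: A) *m E *m dl by eexists.
  have xE : x - mu *: (A *m x) = E *m dl.
    have : (1%:M - mu *: A) *m x = E *m dl by rewrite xdef -mulmxA mulKVmx.
    by rewrite mulmxBl mul1mx -scalemxAl.
  have thx : (th *m x) 0 0 != 0.
    have -> : th *m x = (\det (1%:M - mu *: A))^-1 *: col i (th *m \adj (1%:M - mu *: A) *m E).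
      by rewrite xdef /invmx U -!scalemxAl -scalemxAr colE !mulmxA.
    by rewrite !mxE mulf_neq0 ?invr_neq0 //; move: hi; rewrite mxE.
  rewrite -[k.+1]addn1.
  exists (row_mx X x), (row_mx G (mu^-1 *: dl)), (row_mx d (mu^-1)%:M).
  split.
  - move=> v; rewrite -(vsubmxK v) mul_row_col => hv.
    have d0 : dsubmx v = 0.
      have /(congr1 (mulmx th)) := hv; rewrite mulmxDr !mulmxA thX mul0mx add0r mulmx0.
      rewrite (mx11_scalar (th *m x)) mul_scalar_mx => /eqP.
      by rewrite scaler_eq0 (negPf thx) => /eqP.
    by move: hv; rewrite d0 mulmx0 addr0 => /Xinj ->; rewrite col_mx0.
  - rewrite !mul_mx_row add_row_mx diag_mx_row mul_row_block !mulmx0 addr0 add0r XE.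
    congr row_mx; rewrite -scalemxAr -xE scalerBr scalerA mulVf // scale1r addrC subrK.
    rewrite -mul_mx_scalar; congr (_ *m _).
    by apply/matrixP => a b; rewrite !ord1 !mxE eqxx.
  - have nd a : d 0 a <> mu^-1.
      move=> e; move: hprod; rewrite horner_prod => /prodf_neq0 /(_ a isT).
      by rewrite e invrK !hornerE subrr eqxx.
    move=> a b; case: (splitP a) => [a' ea|a' ea]; case: (splitP b) => [b' eb|b' eb].
    + have -> : a = lshift 1 a' by apply: val_inj.
      have -> : b = lshift 1 b' by apply: val_inj.
      by rewrite !row_mxEl => /dinj ->.
    + have -> : a = lshift 1 a' by apply: val_inj.
      have -> : b = rshift k b' by apply: val_inj.
      by rewrite row_mxEl row_mxEr [RHS]mxE ord1 eqxx => /nd.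
    + have -> : a = rshift k a' by apply: val_inj.
      have -> : b = lshift 1 b' by apply: val_inj.
      by rewrite row_mxEl row_mxEr [LHS]mxE ord1 eqxx => /esym /nd.
    + by move=> _; apply: val_inj; rewrite /= ea eb !ord1.
  - move=> a; case: (splitP a) => [a' ea|a' ea].
      have -> : a = lshift 1 a' by apply: val_inj.
      by rewrite row_mxEl.
    have -> : a = rshift k a' by apply: val_inj.
    by rewrite row_mxEr mxE ord1 eqxx mulr1n invrK invr_eq0.
have [X [G [d [Xinj XE dinj dg]]]] := step f (leqnn f).
have U : X \in unitmx.
  rewrite -unitmx_tr unitmxE unitfE; apply/negP => /det0P [v v0 hv].
  case/eqP: v0; rewrite -(trmxK v) (Xinj v^T) ?trmx0 //.
  by apply: trmx_inj; rewrite trmx_mul trmxK hv trmx0.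
exists (G *m invmx X), X, d; split=> //.
by rewrite mulmxDl -!mulmxA mulVmx // mulmx1.
Qed.

(** Along the moment curve [(1, t, t^2, ...)] each row of [M] becomes a nonzero polynomial in [t],
    so a common non-root gives [eta]. *)
Lemma generic_functional f p (M : 'M[F]_(f, p)) : (forall i, row i M != 0) ->
  exists eta : 'cV[F]_p, forall i, (M *m eta) i 0 != 0.
Proof.
move=> hM.
pose q i : {poly F} := \poly_(j < p) (if insub j is Some j' then M i j' else 0).
have q0 i : q i != 0.
  have [j hj] : exists j, row i M 0 j != 0 by apply/rV0Pn.
  apply/eqP => /polyP /(_ j); rewrite coef_poly coef0 ltn_ord valK => e.
  by move: hj; rewrite mxE e eqxx.
have P0 : \prod_i q i != 0 by apply/prodf_neq0 => i _.
have [t [_ _]] := poly_nonroot P0 (@ltr01 F).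
rewrite horner_prod => /prodf_neq0 ht.
exists (\col_j t ^+ j) => i.
have -> : (M *m \col_j t ^+ j) i 0 = (q i).[t].
  by rewrite horner_poly mxE; apply: eq_bigr => j _; rewrite mxE valK.
exact: ht.
Qed.

(** Kalman decomposition. The columns of [io] span the reachable subspace, which is the image of the
    symmetric Gramian; the rows of [Xi] span the functionals vanishing on it; [pr] and [Y] complete
    them to mutually inverse changes of coordinates. *)
Lemma reach_decomp n m (A : 'M[F]_n) (B : 'M[F]_(n, m)) :
  exists nu f (io : 'M[F]_(n, nu)) (Y : 'M[F]_(n, f)) (pr : 'M[F]_(nu, n))
    (Xi : 'M[F]_(f, n)),
  [/\ [/\ pr *m io = 1%:M, pr *m Y = 0, Xi *m io = 0 & Xi *m Y = 1%:M],
      io *m pr + Y *m Xi = 1%:M, unreach A B Xi &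
      forall k (xi : 'M[F]_(k, n)), unreach A B xi -> xi *m io = 0].
Proof.
pose G := gram A B.
have Gs : G^T = G.
  rewrite /G /gram linear_sum; apply: eq_bigr => j _ /=.
  by rewrite trmx_mul trmxK.
have [Xi XiE] : exists Xi, Xi = row_base (kermx G) by eexists.
have [io ioE] : exists io, io = (row_base G)^T by eexists.
have [D DE] : exists D, row_base G = D *m G by apply/submxP; rewrite eq_row_base.
have killG k (xi : 'M[F]_(k, n)) : unreach A B xi -> xi *m G = 0.
  move=> h; apply/row_matrixP => i; rewrite row_mul row0; apply/unreach_gram => j.
  by rewrite -!row_mul h row0.
have kill_io k (xi : 'M[F]_(k, n)) : unreach A B xi -> xi *m io = 0.
  by move=> /killG h; rewrite ioE DE trmx_mul Gs mulmxA h mul0mx.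
have XiU : unreach A B Xi.
  move=> j; apply/row_matrixP => i; rewrite row_mul (row_mul i Xi) row0.
  suff h : unreach A B (row i Xi) by exact: h.
  apply/unreach_gram/sub_kermxP; apply: (submx_trans (row_sub _ _)).
  by rewrite XiE eq_row_base.
have /row_freeP [Y XiY] : row_free Xi by rewrite XiE row_base_free.
have /row_freeP [P0 P0E] : row_free (row_base G) by exact: row_base_free.
have pio : P0^T *m io = 1%:M by rewrite ioE -trmx_mul P0E trmx1.
have Xio : Xi *m io = 0 by exact: kill_io.
pose N := 1%:M - Y *m Xi.
have XiN : Xi *m N = 0 by rewrite mulmxBr mulmx1 mulmxA XiY mul1mx subrr.
(* The columns of [N] are killed by every functional that kills the image of the Gramian, hence lie
   in that image. *)
have [C NE] : exists C, N = io *m C.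
  have /submxP [C CE] : (N^T <= row_base G)%MS.
    rewrite eq_row_base submxE; apply/eqP.
    have /submxP [E EE] : ((cokermx G)^T <= Xi)%MS.
      rewrite XiE eq_row_base; apply/sub_kermxP.
      by rewrite -{2}Gs -trmx_mul mulmx_coker trmx0.
    by apply: trmx_inj; rewrite trmx_mul trmxK EE -mulmxA XiN mulmx0 trmx0.
  by exists C^T; rewrite ioE -trmx_mul -CE trmxK.
exists _, _, io, Y, (P0^T *m N), Xi; split=> //.
  split=> //.
  - by rewrite mulmxBr mulmx1 mulmxBl pio -!mulmxA Xio !mulmx0 subr0.
  - by rewrite mulmxBr mulmx1 mulmxBl -!mulmxA XiY mulmx1 subrr.
by rewrite mulmxA {1}NE mulmxA -(mulmxA io) pio mulmx1 -NE subrK.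
Qed.

(* Feedback K on the unreachable quotient gives it distinct real modes away from
   the zeros of al (s - A)^-1 B + be; injecting x (al w + be u) through eta then
   excites them.  After scaling the quotient coordinates by x the system tends,
   as x -> 0, to a reachable cascade. *)
Lemma block_perturb nu f m p (A : 'M[F]_nu) (M : 'M[F]_(nu, f)) (Q : 'M[F]_f)
  (B : 'M[F]_(nu, m)) (Ev : 'M[F]_(nu, p)) (Ef : 'M[F]_(f, p)) (alv : 'rV[F]_nu)
  (alf : 'rV[F]_f) (be : 'rV[F]_m) :
  reach A B -> reach Q Ef -> ~ (be = 0 /\ unreach A B alv) ->
  exists (K : 'M[F]_(p, f)) (eta : 'cV[F]_p),
    reach (block_mx A M 0 Q + col_mx Ev Ef *m row_mx 0 K
             + col_mx Ev Ef *m eta *m row_mx alv alf)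
          (col_mx B 0 + col_mx Ev Ef *m eta *m be).
Proof.
move=> hAB hQE /transfer_poly [g [g0 hg]].
have [K [X [d [XU XE dinj dg]]]] := pole_placement hQE g0.
have [eta heta] : exists eta : 'cV[F]_p, forall i, (invmx X *m Ef *m eta) i 0 != 0.
  (* A row of [invmx X] is a left eigenvector of the closed loop; if [Ef] killed it, it would be an
     unreachable functional of [(Q, Ef)]. *)
  apply: generic_functional => i; apply/eqP => hi.
  have XiE : row i (invmx X) *m (Q + Ef *m K) = d 0 i *: row i (invmx X).
    have : invmx X *m (Q + Ef *m K) = diag_mx d *m invmx X.
      by rewrite -[LHS]mulmx1 -(mulmxV XU) !mulmxA -(mulmxA _ _ X) XE mulKmx.
    move=> /(congr1 (row i)); rewrite !row_mul => ->.
    by rewrite row_diag_mx -scalemxAl -rowE.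
  have r0 : row i (invmx X) = 0.
    apply: hQE; apply: (@unreach_inv _ _ _ Q Ef _ _ (d 0 i)%:M); last by rewrite -row_mul.
    by rewrite mul_scalar_mx -XiE mulmxDr (mulmxA _ Ef) -(row_mul i _ Ef) hi mul0mx addr0.
  have : row i (invmx X *m X) 0 i = 0 by rewrite row_mul r0 mul0mx mxE.
  by rewrite mulVmx // !mxE eqxx => /eqP; rewrite oner_eq0.
have [b bE] : exists b, b = invmx X *m Ef *m eta by eexists.
have Xb : X *m b = Ef *m eta by rewrite bE !mulmxA mulmxV // mul1mx.
have casc : reach (block_mx A 0 (b *m alv) (diag_mx d)) (col_mx B (b *m be)).
  apply: cascade_reach => // [k|k psi psiA psiB]; first by rewrite bE.
  have [dk0 /hg [mu0 det0 /eqP]] := dg k; apply.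
  have psiD : psi *m (1%:M - (d 0 k)^-1 *: A) = (d 0 k)^-1 *: alv.
    apply: (scalerI dk0); rewrite scalerA divff // scale1r mulmxBr mulmx1 -scalemxAr.
    by rewrite scalerBr scalerA divff // scale1r -psiA [X in X - _]addrC addrK.
  have -> : be = - (psi *m B) by apply/eqP; rewrite -addr_eq0 addrC psiB.
  rewrite !scalemxAl -psiD -(mulmxA psi) mul_mx_adj mul_mx_scalar -scalemxAl.
  by rewrite scalerN addNr.
(* In the coordinates [diag(1, x X)] the perturbed pair is exactly the cascade plus these terms of
   order [x] and [x^2]. *)
have [g3 [g30 hg3]] := reach_open
  (block_mx (Ev *m eta *m alv) ((M + Ev *m K) *m X) 0 (b *m alf *m X))
  (block_mx 0 (Ev *m eta *m alf *m X) 0 0) (col_mx (Ev *m eta *m be) 0) casc.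
have [x [x0 _ /hg3 hx]] := poly_nonroot g30 (@ltr01 F).
have xn0 : x != 0 by rewrite gt_eqF.
exists K, (x *: eta).
apply: (@reach_conj _ _ _ _ _ _ _ _ (block_mx 1%:M 0 0 (x *: X))
          (block_mx 1%:M 0 0 (x^-1 *: invmx X)) _ _ _ hx).
- rewrite mulmx_block !mulmx0 !mul0mx mulmx1 !addr0 add0r -scalemxAl -scalemxAr.
  by rewrite scalerA divff // scale1r mulmxV // -scalar_mx_block.
- rewrite !scale_block_mx !add_block_mx -!scalemxAr -!scalemxAl. rewrite mul_col_row.
  rewrite (mul_col_mx Ev Ef eta) !mulmx0 mul_col_row scale_block_mx !add_block_mx !mulmx_block.
  rewrite !mulmx1 !mul1mx !mulmx0 !mul0mx !scaler0 !addr0 !add0r.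
  congr block_mx.
  + rewrite -!scalemxAr mulmxDl scalerDr; congr (_ + _).
    by rewrite -scalemxAl scalerA expr2.
  + by rewrite -scalemxAl !mulmxA Xb.
  + rewrite mulmxDl -!scalemxAr XE mulmxDr -!scalemxAl; congr (_ + _).
    by rewrite -!scalemxAr !mulmxA Xb.
rewrite mul_col_mx -!scalemxAr mul_col_mx -!scalemxAl scale_col_mx !add_col_mx mul_block_col.
rewrite !mul1mx !mul0mx scaler0 !addr0 !add0r.
by rewrite -scalemxAl !mulmxA Xb.
Qed.

(** In Kalman coordinates the first hypothesis says that [E] reaches the unreachable quotient, and
    the second that the transfer row of [al], [be] is nonzero on the reachable part. The feedback
    factors through [Xi], so it is invisible on states reached from zero. *)
Lemma perturb_reach n m p (A : 'M[F]_n) (B : 'M[F]_(n, m)) (E : 'M[F]_(n, p))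
  (al : 'rV[F]_n) (be : 'rV[F]_m) :
  (forall xi : 'rV[F]_n, unreach A B xi -> unreach A E xi -> xi = 0) ->
  ~ (be = 0 /\ unreach A B al) ->
  exists (K : 'M[F]_(p, n)) (eta : 'cV[F]_p),
    unreach A B K /\ reach (A + E *m K + E *m eta *m al) (B + E *m eta *m be).
Proof.
move=> hE hab.
have [nu [f [io [Y [pr [Xi [[prio prY Xiio XiY] one XiU kill]]]]]]] := reach_decomp A B.
have XiB : Xi *m B = 0 by exact: unreach0.
have split1 k (Z : 'M[F]_(n, k)) : Z = io *m (pr *m Z) + Y *m (Xi *m Z).
  by rewrite !mulmxA -mulmxDl one mul1mx.
have Aio : A *m io = io *m (pr *m A *m io).
  by rewrite [LHS]split1 (mulmxA Xi) (kill _ (Xi *m A)) ?mulmx0 ?addr0 ?mulmxA //; exact: unreach_step.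
have AY : A *m Y = io *m (pr *m A *m Y) + Y *m (Xi *m A *m Y).
  by rewrite [LHS]split1 !mulmxA.
have Bio : B = io *m (pr *m B) by rewrite [LHS]split1 XiB mulmx0 addr0.
have XiA : Xi *m A = Xi *m A *m Y *m Xi.
  rewrite -[LHS]mulmx1 -one mulmxDr !mulmxA (kill _ (Xi *m A)) ?mul0mx ?add0r //.
  exact: unreach_step.
have hV : reach (pr *m A *m io) (pr *m B).
  move=> xi hxi.
  have : xi *m pr *m io = 0.
    apply: kill => j.
    rewrite Bio [LHS]mulmxA -(mulmxA _ _ io) (pow_intertwine j Aio) (mulmxA (xi *m pr)).
    by rewrite -(mulmxA xi pr) prio mulmx1; exact: hxi.
  by rewrite -mulmxA prio mulmx1.
have hF : reach (Xi *m A *m Y) (Xi *m E).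
  move=> th hth.
  have th0 : th *m Xi = 0.
    apply: hE; first exact: unreachM.
    move=> j.
    have P i : Xi *m A ^+ i = (Xi *m A *m Y) ^+ i *m Xi.
      elim: i => [|i IH]; first by rewrite !expr0 mulmx1 mul1mx.
      by rewrite exprSrmx mulmxA IH [in RHS]exprSrmx -!(mulmxA (_ ^+ i)) -XiA.
    by rewrite -(mulmxA th) P mulmxA -mulmxA hth.
  by rewrite -(mulmx1 th) -XiY mulmxA th0 mul0mx.
have hab' : ~ (be = 0 /\ unreach (pr *m A *m io) (pr *m B) (al *m io)).
  move=> [be0 h]; apply: hab; split=> // j.
  rewrite Bio [LHS]mulmxA -(mulmxA al) (pow_intertwine j Aio) (mulmxA al).
  exact: h.
have [K [eta h]] := block_perturb (pr *m A *m Y) (pr *m E) (al *m Y) hV hF hab'.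
exists (K *m Xi), eta; split; first exact: unreachM.
have EE : E = row_mx io Y *m col_mx (pr *m E) (Xi *m E).
  by rewrite mul_row_col -split1.
apply: (@reach_conj _ _ _ _ _ _ _ _ (row_mx io Y) (col_mx pr Xi) _ _ _ h).
- by rewrite mul_row_col.
- rewrite !mulmxDl !mulmxDr; congr (_ + _ + _).
  + by rewrite mul_mx_row mul_row_block Aio AY mulmx0 addr0.
  + rewrite {1}EE -!mulmxA; congr (_ *m (_ *m _)).
    by rewrite !mul_mx_row Xiio XiY mulmx0 mulmx1.
  + by rewrite {1}EE -!mulmxA mul_mx_row.
rewrite mulmxDr {1}Bio mul_row_col mulmx0 addr0; congr (_ + _).
by rewrite {1}EE -!mulmxA.
Qed.
End Perturbation.

(** * Windows *)

Section Stacking.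
Variable R : realType.

Lemma mxgetE n1 n2 (M : 'M[R]_(n1, n2)) i j (hi : (i < n1)%N) (hj : (j < n2)%N) :
  mxget M i j = M (Ordinal hi) (Ordinal hj).
Proof. by rewrite /mxget !insubT. Qed.

Lemma mxget_ord n1 n2 (M : 'M[R]_(n1, n2)) (i : 'I_n1) (j : 'I_n2) : mxget M i j = M i j.
Proof. by rewrite /mxget !valK. Qed.

Definition stack k (f : nat -> 'cV[R]_k) N : 'cV[R]_(N * k) :=
  \col_(r < N * k) mxget (f (r %/ k)%N) (r %% k) 0.

(** Left multiplication extracts block [a] of a stacked vector, and the transpose inserts one. It is
    zero for [a >= N], so [wshift] leaves the last block empty for the incoming sample. *)
Definition sel N k a : 'M[R]_(k, N * k) :=
  \matrix_(b, r) (r == (a * k + b)%N :> nat)%:R.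

Lemma width_gt0 N k (r : 'I_(N * k)) : (0 < k)%N.
Proof. by case: r => r; case: k => //; rewrite muln0. Qed.

Lemma block_lt N k a (b : 'I_k) : (a < N)%N -> (a * k + b < N * k)%N.
Proof. by have := ltn_ord b; nia. Qed.

Lemma sel_entry N k a (aN : (a < N)%N) l (X : 'M[R]_(N * k, l)) (b : 'I_k) c :
  (sel N k a *m X) b c = X (Ordinal (block_lt b aN)) c.
Proof.
rewrite mxE (bigD1 (Ordinal (block_lt b aN))) //= big1 => [|r hr].
  by rewrite mxE eqxx mul1r addr0.
rewrite mxE; case: eqP => [e|_]; last by rewrite mul0r.
by case/eqP: hr; apply: val_inj.
Qed.

Lemma sel_stack k (f : nat -> 'cV[R]_k) N a : (a < N)%N ->
  sel N k a *m stack f N = f a.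
Proof.
move=> aN; apply/colP => b; rewrite (sel_entry aN) mxE /=.
have k0 : (0 < k)%N := leq_ltn_trans (leq0n b) (ltn_ord b).
rewrite divnMDl // divn_small // addn0 modnMDl modn_small //.
exact: (mxget_ord (f a) b ord0).
Qed.

Lemma sel_out N k a : (N <= a)%N -> sel N k a = 0.
Proof.
move=> aN; apply/matrixP => b r; rewrite !mxE; case: eqP => // e.
by have := ltn_ord r; have := ltn_ord b; nia.
Qed.

Lemma sel_inj N k l (X Y : 'M[R]_(N * k, l)) :
  (forall a, (a < N)%N -> sel N k a *m X = sel N k a *m Y) -> X = Y.
Proof.
move=> h; apply/matrixP => r c.
have k0 : (0 < k)%N := width_gt0 r.
have aN : (r %/ k < N)%N by rewrite ltn_divLR.
have bk : (r %% k < k)%N by rewrite ltn_pmod.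
have /matrixP/(_ (Ordinal bk) c) := h _ aN.
rewrite !(sel_entry aN); suff -> : Ordinal (block_lt (Ordinal bk) aN) = r by [].
by apply: val_inj; rewrite /= -divn_eq.
Qed.

Lemma eq_stack k (f g : nat -> 'cV[R]_k) N :
  (forall a, (a < N)%N -> f a = g a) -> stack f N = stack g N.
Proof. by move=> h; apply: sel_inj => a aN; rewrite !sel_stack // h. Qed.

Lemma sel_tr N k a b : (a < N)%N -> (b < N)%N ->
  sel N k a *m (sel N k b)^T = (a == b)%:R%:M.
Proof.
move=> aN bN; apply/matrixP => i j; rewrite (sel_entry aN) !mxE /=.
case: (eqVneq a b) => [->|ab]; first by rewrite eqn_add2l.
rewrite mul0rn; case: eqP => // e; case/eqP: ab.
by have := ltn_ord i; have := ltn_ord j; nia.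
Qed.

Lemma stack_sum k (f : nat -> 'cV[R]_k) N :
  \sum_(a < N) (sel N k a)^T *m f a = stack f N.
Proof.
apply: sel_inj => a aN; rewrite sel_stack // mulmx_sumr (bigD1 (Ordinal aN)) //=.
rewrite mulmxA sel_tr // eqxx mul1mx big1 ?addr0 // => i hi.
rewrite mulmxA sel_tr // (_ : (a == i) = false) ?mul_scalar_mx ?scale0r //.
by apply/negbTE; apply: contra hi => /eqP e; apply/eqP/val_inj.
Qed.

Lemma stack_sel k N (x : 'cV[R]_(N * k)) : stack (fun a => sel N k a *m x) N = x.
Proof. by apply: sel_inj => a aN; rewrite sel_stack. Qed.

Lemma obsv_stack p n k (C : 'M[R]_(p, n)) (A : 'M[R]_n) (x : 'cV[R]_n) :
  obsv k C A *m x = stack (fun j => C *m A ^+ j *m x) k.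
Proof.
apply/colP => r; rewrite !mxE.
have p0 : (0 < p)%N := width_gt0 r.
have bk : (r %% p < p)%N by rewrite ltn_pmod.
rewrite (mxgetE _ bk (ltn0Sn 0)) mxE; apply: eq_bigr => j _.
rewrite mxE (mxgetE _ bk (ltn_ord j)).
have -> : Ordinal (ltn_ord j) = j by apply: val_inj.
by have -> : Ordinal (ltn0Sn 0) = 0 by apply: val_inj.
Qed.

Section Windows.
Variables m p : nat.
Local Notation q := (m + p)%N.
Implicit Types (w : traj R m p).

Lemma win_stack w t N : win w t N = stack (fun a => w (t + a)%N) N.
Proof. by []. Qed.

Lemma sel_win w t N a : (a < N)%N -> sel N q a *m win w t N = w (t + a)%N.
Proof. by move=> aN; rewrite win_stack sel_stack. Qed.

Lemma eq_win w w' t t' N : (forall a, (a < N)%N -> w (t + a)%N = w' (t' + a)%N) ->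
  win w t N = win w' t' N.
Proof. by move=> h; rewrite !win_stack; apply: eq_stack. Qed.

Lemma win_inj w w' t t' N : win w t N = win w' t' N ->
  forall a, (a < N)%N -> w (t + a)%N = w' (t' + a)%N.
Proof. by move=> h a aN; rewrite -(sel_win w t aN) h sel_win. Qed.

Lemma winD w w' t N : win (fun i => w i + w' i) t N = win w t N + win w' t N.
Proof. by apply: sel_inj => a aN; rewrite mulmxDr !sel_win. Qed.

Lemma winZ c w t N : win (fun i => c *: w i) t N = c *: win w t N.
Proof. by apply: sel_inj => a aN; rewrite -scalemxAr !sel_win. Qed.

Lemma unwin N (x : 'cV[R]_(N * q)) :
  exists w, win w 0 N = x /\ forall a, (N <= a)%N -> w a = 0.
Proof.
exists (fun a => sel N q a *m x); split; first exact: stack_sel.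
by move=> a /sel_out ->; rewrite mul0mx.
Qed.

Lemma win_split l N (rho : 'M[R]_(l, N.+1 * q)) w t :
  rho *m win w t N.+1 =
  (\sum_(a < N) rho *m (sel N.+1 q a)^T *m sel N q a) *m win w t N
  + rho *m (sel N.+1 q N)^T *m w (t + N)%N.
Proof.
rewrite win_stack -stack_sum mulmx_sumr big_ord_recr /= mulmxA; congr (_ + _).
by rewrite mulmx_suml; apply: eq_bigr => a _; rewrite -mulmxA sel_win // mulmxA.
Qed.

Definition wshift L : 'M[R]_(L * q) := \sum_(a < L) (sel L q a)^T *m sel L q a.+1.
(** The sum has one term if [0 < L] and none if [L = 0], which covers memoryless models without a
    case distinction. *)
Definition wlast L : 'M[R]_(L * q, q) := \sum_(a < L | a.+1 == L) (sel L q a)^T.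

Lemma win_next w t L : win w t.+1 L = wshift L *m win w t L + wlast L *m w (t + L)%N.
Proof.
rewrite [LHS]win_stack -stack_sum !mulmx_suml [X in _ + X]big_mkcond -big_split /=.
apply: eq_bigr => a _; rewrite -mulmxA addSnnS.
case: eqP => [e|ne]; first by rewrite (@sel_out _ _ a.+1) ?e // mul0mx mulmx0 add0r.
by rewrite addr0 sel_win //; have := ltn_ord a; lia.
Qed.

(** A shifted identity: both paddings are congruences by it, which reduces their quadratic forms on
    a window to forms on a subwindow. *)
Definition placed n K (off : nat) : 'M[R]_(n, K) := \matrix_(i, j) (j == (i + off)%N :> nat)%:R.

Lemma placed_sum n (f : 'I_n -> R) (j off : nat) :
  \sum_(b < n) f b * (j == (b + off)%N :> nat)%:R =
  if (off <= j)%N then oapp f 0 (insub (j - off)%N) else 0.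
Proof.
case: leqP => [oj|jo]; last first.
  by rewrite big1 // => b _; case: eqP => [e|]; rewrite ?mulr0 //; lia.
case: insubP => [b _ e|nb] /=.
  rewrite (bigD1 b) //= big1 => [|c cb].
    by rewrite e subnK // eqxx mulr1 addr0.
  case: eqP => [e2|]; rewrite ?mulr0 //; case/eqP: cb; apply: val_inj => /=.
  by rewrite e e2 addnK.
rewrite big1 // => b _; case: eqP => [e|]; rewrite ?mulr0 //.
by move: nb; rewrite e addnK ltn_ord.
Qed.

Lemma placedE n K off (M : 'M[R]_n) (i j : 'I_K) :
  ((placed n K off)^T *m M *m placed n K off) i j =
  if (off <= i)%N && (off <= j)%N then mxget M (i - off)%N (j - off)%N else 0.
Proof.
rewrite mxE.
under eq_bigr => b _ do rewrite [placed _ _ _ b j]mxE.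
rewrite placed_sum andbC /mxget; case: leqP => //= _.
have E b : ((placed n K off)^T *m M) i b =
    if (off <= i)%N then oapp (M^~ b) 0 (insub (i - off)%N) else 0.
  by rewrite mxE -placed_sum; apply: eq_bigr => a _; rewrite !mxE mulrC.
case: insubP => [b _ _|_] /=; last by case: insubP; rewrite if_same.
by rewrite E; case: insubP.
Qed.

Lemma padTL_placed n K (M : 'M[R]_n) :
  padTL K M = (placed n K 0)^T *m M *m placed n K 0.
Proof. by apply/matrixP => i j; rewrite placedE mxE !subn0. Qed.

Lemma padBR_placed n K k (M : 'M[R]_n) :
  padBR K k M = (placed n K k)^T *m M *m placed n K k.
Proof. by apply/matrixP => i j; rewrite placedE mxE. Qed.

Lemma placed_win N K s off w t : off = (s * q)%N -> (s + N <= K)%N ->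
  placed (N * q) (K * q) off *m win w t K = win w (t + s)%N N.
Proof.
move=> -> sN; apply/colP => i.
have hi : (i + s * q < K * q)%N by have := ltn_ord i; nia.
have q0 : (0 < q)%N := width_gt0 i.
rewrite mxE (bigD1 (Ordinal hi)) //= big1 => [|r hr].
  rewrite !mxE /= eqxx mul1r addr0 (addnC i) divnMDl // modnMDl.
  by rewrite addnA.
rewrite mxE; case: eqP => [e|_]; last by rewrite mul0r.
by case/eqP: hr; apply: val_inj.
Qed.

Lemma quad_mul n l (J : 'M[R]_(n, l)) (M : 'M[R]_n) (x : 'cV[R]_l) :
  x^T *m (J^T *m M *m J) *m x = (J *m x)^T *m M *m (J *m x).
Proof. by rewrite trmx_mul !mulmxA. Qed.

Lemma qdf_padTL N K (Phi : 'M[R]_(N * q)) w t : (N <= K)%N ->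
  qdf (padTL (K * q) Phi) w t = qdf Phi w t.
Proof.
by move=> NK; rewrite /qdf padTL_placed quad_mul (@placed_win _ _ 0) // addn0.
Qed.

Lemma qdf_nabla N (Psi : 'M[R]_(N * q)) w t :
  qdf (nabla Psi) w t = qdf Psi w t.+1 - qdf Psi w t.
Proof.
rewrite -[qdf Psi w t](@qdf_padTL N N.+1) // /qdf /nabla mulmxBr mulmxBl mxE [X in _ + X]mxE.
congr (_ - _); rewrite -[in RHS](addn1 t).
by rewrite padBR_placed quad_mul (@placed_win _ _ 1) ?mul1n.
Qed.

Lemma lmi_win N d (Phi : 'M[R]_(N * q)) (Psi : 'M[R]_(d * q)) w t : (N <= d.+1)%N ->
  ((win w t d.+1)^T *m lmi_mx Phi Psi *m win w t d.+1) 0 0 =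
  qdf Phi w t - qdf (nabla Psi) w t.
Proof.
move=> Nd; rewrite -(qdf_padTL Phi w t Nd) /qdf /lmi_mx /nabla.
set TP := padTL _ Psi; set BP := padBR _ _ Psi; set TF := padTL _ Phi.
have E M1 M2 : ((win w t d.+1)^T *m (M1 + M2) *m win w t d.+1) 0 0 =
    ((win w t d.+1)^T *m M1 *m win w t d.+1) 0 0 +
    ((win w t d.+1)^T *m M2 *m win w t d.+1) 0 0.
  by rewrite mulmxDr mulmxDl mxE.
have EN M : ((win w t d.+1)^T *m (- M) *m win w t d.+1) 0 0 =
    - ((win w t d.+1)^T *m M *m win w t d.+1) 0 0.
  by rewrite mulmxN mulNmx mxE.
by rewrite !E !EN; ring.
Qed.

Lemma hankel_mul k T (wd : traj R m p) (v : 'cV[R]_(T - k + 1)) :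
  hankel k T wd *m v = \sum_j v j 0 *: win wd j k.
Proof.
apply/colP => r; rewrite mxE summxE; apply: eq_bigr => j _.
by rewrite !mxE mulrC (addnC j).
Qed.
End Windows.
End Stacking.

(** * State-space behaviors *)

Section StateSpace.
Variables (R : realType) (m p : nat).
Local Notation q := (m + p)%N.
Implicit Types w : traj R m p.

Lemma submx_ker n1 n2 n (M : 'M[R]_(n1, n)) (N : 'M[R]_(n2, n)) :
  (forall c : 'cV[R]_n, N *m c = 0 -> M *m c = 0) -> (M <= N)%MS.
Proof.
move=> h; rewrite submxE; apply/eqP/row_matrixP => i; apply/rowP => j.
have /h/colP/(_ i) : N *m col j (cokermx N) = 0.
  by rewrite colE mulmxA mulmx_coker mul0mx.
by rewrite colE mulmxA -colE !mxE.
Qed.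

Section Representation.
Variables (n : nat) (A : 'M[R]_n) (B : 'M[R]_(n, m)) (C : 'M[R]_(p, n)) (D : 'M[R]_(p, m)).
Local Notation beh := (ss_behavior A B C D).

Definition sim s u : traj R m p :=
  fun t => col_mx (u t) (C *m state A B s u t + D *m u t).

Lemma sim_ss s u : beh (sim s u).
Proof. by exists (state A B s u) => t; rewrite col_mxKu col_mxKd. Qed.

Lemma ss_sim w : beh w -> exists s, forall t, w t = sim s (fun i => usubmx (w i)) t.
Proof.
move=> [x hx]; exists (x 0%N) => t.
have E i : x i = state A B (x 0%N) (fun i => usubmx (w i)) i.
  by elim: i => //= i IH; rewrite -IH (hx i).1.
by rewrite /sim -E -(hx t).2 vsubmxK.
Qed.

Lemma eq_sim s u u' t : (forall i, (i <= t)%N -> u i = u' i) -> sim s u t = sim s u' t.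
Proof.
move=> h; rewrite /sim h // (@eq_state _ _ _ _ _ _ u u') // => i it; apply: h.
exact: ltnW.
Qed.

Lemma ss_ext w w' : beh w -> (forall t, w t = w' t) -> beh w'.
Proof. by move=> [x hx] e; exists x => t; rewrite -e. Qed.

Lemma ss_shift w k : beh w -> beh (fun t => w (k + t)%N).
Proof. by move=> [x hx]; exists (fun t => x (k + t)%N) => t; rewrite addnS. Qed.

Lemma ss0 : beh (fun=> 0).
Proof. by exists (fun=> 0) => t; rewrite [usubmx 0]linear0 [dsubmx 0]linear0 !mulmx0 !addr0. Qed.

Lemma ss_lin c w w' : beh w -> beh w' -> beh (fun t => c *: w t + w' t).
Proof.
move=> [x hx] [x' hx']; exists (fun t => c *: x t + x' t) => t.
rewrite (hx t).1 (hx' t).1 [usubmx (_ + _)]linearP [dsubmx (_ + _)]linearP /= (hx t).2 (hx' t).2 !mulmxDr -!scalemxAr !scalerDr.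
by split; rewrite addrACA.
Qed.

Lemma ss_sum (I : Type) (r : seq I) (c : I -> R) (W : I -> traj R m p) :
  (forall i, beh (W i)) -> beh (fun t => \sum_(i <- r) c i *: W i t).
Proof.
move=> h; elim: r => [|i r IH].
  by apply: (ss_ext ss0) => t; rewrite big_nil.
by apply: (ss_ext (ss_lin (c i) (h i) IH)) => t; rewrite big_cons.
Qed.

Lemma state0 s k : state A B s (fun=> 0) k = A ^+ k *m s.
Proof.
rewrite state_sum big1 ?addr0 // => i _; by rewrite mulmx0.
Qed.

Lemma state_diff s s' u k : state A B s u k - state A B s' u k = A ^+ k *m (s - s').
Proof. by rewrite !state_sum mulmxBr opprD addrACA subrr addr0. Qed.

Lemma state_succ s u k : state A B s u k.+1 = state A B (A *m s + B *m u 0%N) (fun i => u i.+1) k.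
Proof. exact: (state_add A B s u 1 k). Qed.

Section Lag.
Variable k : nat.
Hypothesis lagk : is_lag C A k.

(** Equal ranks make the row spaces of [obsv k C A] and [obsv k.+1 C A] equal, so the kernel of the
    former is invariant under [A] and contained in the kernel of [C]. *)
Lemma lag_obs (c : 'cV[R]_n) :
  (forall j, (j < k)%N -> C *m A ^+ j *m c = 0) -> forall j, C *m A ^+ j *m c = 0.
Proof.
have obs0 l (x : 'cV[R]_n) : obsv l C A *m x = 0 <-> forall j, (j < l)%N -> C *m A ^+ j *m x = 0.
  rewrite obsv_stack; split=> [h j jl|h].
    by rewrite -(sel_stack (fun j => C *m A ^+ j *m x) jl) h mulmx0.
  by apply: sel_inj => a al; rewrite sel_stack // h // mulmx0.
have sub1 : (obsv k C A <= obsv k.+1 C A)%MS.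
  by apply: submx_ker => x /obs0 h; apply/obs0 => j jk; apply: h; apply: leqW.
have sub2 : (obsv k.+1 C A <= obsv k C A)%MS.
  by rewrite -(geq_leqif (mxrank_leqif_sup sub1)) lagk.1.
have step (x : 'cV[R]_n) : (forall j, (j < k)%N -> C *m A ^+ j *m x = 0) ->
    forall j, (j < k)%N -> C *m A ^+ j *m (A *m x) = 0.
  move=> /obs0 h j jk; rewrite mulmxA -(mulmxA C) -exprSrmx; apply: (proj1 (obs0 k.+1 x)) => //.
  by case/submxP: sub2 => M ->; rewrite -mulmxA h mulmx0.
have last (x : 'cV[R]_n) : (forall j, (j < k)%N -> C *m A ^+ j *m x = 0) -> C *m x = 0.
  move=> /obs0 h; have /obs0/(_ 0%N isT) : obsv k.+1 C A *m x = 0.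
    by case/submxP: sub2 => M ->; rewrite -mulmxA h mulmx0.
  by rewrite expr0 mulmx1.
move=> h j; elim: j c h => [|j IH] x h; first by rewrite expr0 mulmx1 last.
by rewrite exprSrmx !mulmxA -(mulmxA _ A); apply/IH/step.
Qed.

Lemma lag_zero w : beh w -> (forall t, usubmx (w t) = 0) ->
  (forall t, (t < k)%N -> w t = 0) -> forall t, w t = 0.
Proof.
move=> /ss_sim [s hs] hu hw t.
have E i : w i = col_mx 0 (C *m A ^+ i *m s).
  rewrite hs (@eq_sim _ _ (fun=> 0)) //= /sim state0 mulmx0 addr0.
  by rewrite mulmxA.
rewrite E lag_obs ?col_mx0 // => j jk.
by have := hw j jk; rewrite E => /(congr1 dsubmx); rewrite col_mxKd linear0.
Qed.

(** Each window provides a state at its start. Consecutive windows overlap in [d >= k] samples, so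
    the propagated state and the state of the next window differ by an unobservable vector;
    propagating one initial state therefore explains all of [w]. *)
Lemma ss_windows d w : (k <= d)%N ->
  (forall t, exists w', beh w' /\ win w t d.+1 = win w' 0 d.+1) -> beh w.
Proof.
move=> kd hw.
pose u i := usubmx (w i).
pose cons x t := forall j, (j <= d)%N ->
  dsubmx (w (t + j)%N) = C *m state A B x (fun i => u (t + i)%N) j + D *m u (t + j)%N.
have ex t : exists x, cons x t.
  have [w' [/ss_sim [s hs] /win_inj e]] := hw t.
  exists s => j jd; rewrite e // hs /u e // add0n /sim col_mxKd; congr (C *m _ + _).
  by apply: eq_state => i ij; rewrite /u e ?add0n // ltnW //; lia.
have next x t : cons x t -> cons (A *m x + B *m u t) t.+1.
  move=> hx j jd; have [x' hx'] := ex t.+1.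
  rewrite hx' //; congr (_ + _).
  set v := fun i => u (t.+1 + i)%N; set x1 := A *m x + _.
  apply/eqP; rewrite -subr_eq0 -mulmxBr state_diff mulmxA; apply/eqP/lag_obs => i ik.
  have id : (i < d)%N by exact: leq_trans ik kd.
  have := hx i.+1 id; rewrite addnS -addSn hx' ?(ltnW id) //.
  move/addIr; rewrite state_succ addn0 => e.
  rewrite -mulmxA -(state_diff _ _ v) mulmxBr e; apply/eqP; rewrite subr_eq0; apply/eqP.
  by congr (C *m _); apply: eq_state => l _; rewrite addnS.
have [x0 hx0] := ex 0%N.
exists (state A B x0 u) => t; split=> //.
have hc i : cons (state A B x0 u i) i by elim: i => // i /next.
by have := hc t 0%N isT; rewrite addn0.
Qed.
End Lag.

Definition param_u K j : 'M[R]_(m, n + K * m) := row_mx 0 (sel R K m j).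
Fixpoint param_x K j : 'M[R]_(n, n + K * m) :=
  if j is j'.+1 then A *m param_x K j' + B *m param_u K j' else row_mx 1%:M 0.
(* win w t K = param K *m (state at t, inputs on [t, t+K-1]) *)
Definition param K : 'M[R]_(K * q, n + K * m) :=
  \sum_(j < K) (sel R K q j)^T *m col_mx (param_u K j) (C *m param_x K j + D *m param_u K j).

Lemma param_win K s u : param K *m col_mx s (stack u K) = win (sim s u) 0 K.
Proof.
have uE j : (j < K)%N -> param_u K j *m col_mx s (stack u K) = u j.
  by move=> jK; rewrite mul_row_col mul0mx add0r sel_stack.
have xE j : (j <= K)%N -> param_x K j *m col_mx s (stack u K) = state A B s u j.
  elim: j => [_|j IH jK]; first by rewrite mul_row_col mul1mx mul0mx addr0.
  by rewrite /= mulmxDl -!mulmxA IH ?uE // ltnW.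
rewrite [RHS]win_stack -[RHS]stack_sum mulmx_suml; apply: eq_bigr => j _.
rewrite -mulmxA mul_col_mx mulmxDl -!mulmxA uE // xE ?add0n // ltnW //.
Qed.

Lemma param_surj K (v : 'cV[R]_(n + K * m)) :
  exists s u, v = col_mx s (stack u K) /\ forall t, (K <= t)%N -> u t = 0.
Proof.
exists (usubmx v), (fun j => sel R K m j *m dsubmx v); split.
  by rewrite stack_sel vsubmxK.
by move=> t Kt; rewrite sel_out // mul0mx.
Qed.

Lemma win_param K w t : beh w -> exists v, win w t K = param K *m v.
Proof.
move=> /(ss_shift t) /ss_sim [s hs].
exists (col_mx s (stack (fun i => usubmx (w (t + i)%N)) K)).
by rewrite param_win; apply: eq_win => a _; rewrite add0n -hs.
Qed.

Lemma param_full K : (forall c : 'cV[R]_n,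
  (forall j, (j < K)%N -> C *m A ^+ j *m c = 0) -> c = 0) ->
  \rank (param K) = (n + K * m)%N.
Proof.
move=> obs; apply/eqP; rewrite -mxrank_tr; apply/row_freeP.
suff : row_free (param K)^T by move/row_freeP.
rewrite -kermx_eq0; apply/rowV0P => v /sub_kermxP hv.
have {hv} : param K *m v^T = 0 by apply: trmx_inj; rewrite trmx_mul trmxK hv trmx0.
have [s [u [vE hu]]] := param_surj v^T.
rewrite vE param_win => h0.
have h j : (j < K)%N -> sim s u j = 0.
  by move=> jK; rewrite -[j]add0n -(sel_win (sim s u) 0 jK) h0 mulmx0.
have u0 t : u t = 0.
  case: (ltnP t K) => [/h|/hu //].
  by rewrite -[X in _ = X]col_mx0 => /eq_col_mx [].
suff s0 : s = 0.
  apply: trmx_inj; rewrite vE s0 trmx0 (@eq_stack _ _ u (fun=> 0)) //.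
  by rewrite -[RHS]col_mx0; congr col_mx; apply: sel_inj => a aK; rewrite sel_stack // mulmx0.
apply: obs => j jK; have := h j jK; rewrite -[X in _ = X]col_mx0 => /eq_col_mx [_].
by rewrite (@eq_state _ _ _ _ _ _ u (fun=> 0)) // state0 u0 mulmx0 addr0 mulmxA.
Qed.

(** [Z] and [Y1] map an initial state and inputs to the past window with the current input, and to
    the current output. On the kernel of [Z] the output is [C A^L s] with [C A^j s = 0] for [j < L],
    which the lag forces to vanish; hence [Y1] factors through [Z]. *)
Lemma arx_of_lag k L : is_lag C A k -> (k <= L)%N ->
  exists (Y : 'M[R]_(p, L * q)) (D0 : 'M[R]_(p, m)), forall w t, beh w ->
    dsubmx (w (t + L)%N) = Y *m win w t L + D0 *m usubmx (w (t + L)%N).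
Proof.
move=> lagk kL.
pose P := param L.+1.
pose Z := col_mx (\sum_(a < L) (sel R L q a)^T *m (sel R L.+1 q a *m P))
                 (usubmx (sel R L.+1 q L *m P)).
pose Y1 := dsubmx (sel R L.+1 q L *m P).
have selP s u j : (j < L.+1)%N ->
    sel R L.+1 q j *m P *m col_mx s (stack u L.+1) = sim s u j.
  by move=> jL; rewrite -mulmxA param_win sel_win.
have ZE s u : Z *m col_mx s (stack u L.+1) = col_mx (win (sim s u) 0 L) (u L).
  rewrite mul_col_mx mul_usub_mx selP // col_mxKu; congr col_mx.
  rewrite [RHS]win_stack -[RHS]stack_sum mulmx_suml; apply: eq_bigr => a _.
  by rewrite -mulmxA selP ?add0n // ltnW // ltnS.
have YE s u : Y1 *m col_mx s (stack u L.+1) = dsubmx (sim s u L).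
  by rewrite mul_dsub_mx selP.
have /submxP [Th ThE] : (Y1 <= Z)%MS.
  apply: submx_ker => v; have [s [u [-> _]]] := param_surj v.
  rewrite ZE YE -[X in _ = X]col_mx0 => /eq_col_mx [h0 uL].
  have h j : (j < L)%N -> sim s u j = 0.
    by move=> jL; rewrite -[j]add0n -(sel_win (sim s u) 0 jL) h0 mulmx0.
  have u0 j : (j < L)%N -> u j = 0.
    by move/h; rewrite -[X in _ = X]col_mx0 => /eq_col_mx [].
  have E j : (j <= L)%N -> sim s u j = col_mx (u j) (C *m A ^+ j *m s + D *m u j).
    move=> jL; rewrite /sim (@eq_state _ _ _ _ _ _ u (fun=> 0)) ?state0 ?mulmxA // => i ij.
    by apply: u0; exact: leq_trans ij jL.
  rewrite E // col_mxKd uL mulmx0 addr0; apply: (lag_obs lagk) => j jk.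
  have jL : (j < L)%N := leq_trans jk kL.
  have := h j jL; rewrite E ?(ltnW jL) // -[X in _ = X]col_mx0 => /eq_col_mx [_].
  by rewrite u0 // mulmx0 addr0.
exists (lsubmx Th), (rsubmx Th) => w t /(ss_shift t) /ss_sim [s hs].
rewrite hs -YE ThE -mulmxA ZE -{1}(hsubmxK Th) mul_row_col.
congr (_ + _); congr (_ *m _).
  by apply: eq_win => a _; rewrite add0n -hs.
by rewrite -hs.
Qed.
End Representation.
End StateSpace.

(** * Data and models *)

Section Behaviors.
Variables (R : realType) (m p : nat).
Local Notation q := (m + p)%N.
Implicit Types w : traj R m p.

(** The state space is divided by the unobservable subspace, the kernel of [obsv k C A]; the rows of
    [Q] are coordinates on the quotient. *)
Lemma observable_reduction n (A : 'M[R]_n) (B : 'M[R]_(n, m)) (C : 'M[R]_(p, n))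
  (D : 'M[R]_(p, m)) k : is_lag C A k ->
  exists r (A' : 'M[R]_r) (B' : 'M[R]_(r, m)) (C' : 'M[R]_(p, r)),
    (forall c : 'cV[R]_r, (forall j, (j < k)%N -> C' *m A' ^+ j *m c = 0) -> c = 0) /\
    forall w, ss_behavior A B C D w <-> ss_behavior A' B' C' D w.
Proof.
move=> lagk; pose O := obsv k C A.
have [Q QE] : exists Q, Q = row_base O by eexists.
have eqQ : (Q :=: O)%MS by rewrite QE; exact: eq_row_base.
have O0 (x : 'cV[R]_n) : O *m x = 0 -> forall j, C *m A ^+ j *m x = 0.
  rewrite /O obsv_stack => h; apply: (lag_obs lagk) => j jk.
  by rewrite -(sel_stack (fun j => C *m A ^+ j *m x) jk) h mulmx0.
have [C' CE] : exists C', C = C' *m Q.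
  apply/submxP; rewrite eqQ; apply: submx_ker => c /O0 /(_ 0%N).
  by rewrite expr0 mulmx1.
have [A' AE] : exists A', Q *m A = A' *m Q.
  apply/submxP; rewrite eqQ (eqmxMr A eqQ); apply: submx_ker => c /O0 h.
  rewrite -mulmxA /O obsv_stack; apply: sel_inj => j jk.
  by rewrite sel_stack // mulmx0 mulmxA -(mulmxA C) -exprSrmx.
have /row_freeP [Y QY] : row_free Q by rewrite QE row_base_free.
exists _, A', (Q *m B), C'; split.
  move=> c hc; have [M ME] : exists M, Q = M *m O by apply/submxP; rewrite eqQ.
  have OY : O *m (Y *m c) = 0.
    rewrite /O obsv_stack; apply: sel_inj => j jk; rewrite sel_stack // mulmx0.
    rewrite {1}CE -(mulmxA C') -(pow_intertwine j (esym AE)) -!mulmxA (mulmxA Q).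
    by rewrite QY mul1mx mulmxA hc.
  have -> : c = Q *m (Y *m c) by rewrite mulmxA QY mul1mx.
  by rewrite {1}ME -mulmxA OY mulmx0.
move=> w; split=> [[x hx]|/ss_sim [s hs]].
  exists (fun t => Q *m x t) => t; rewrite (hx t).1 (hx t).2 mulmxDr !mulmxA AE.
  by rewrite {1}CE.
have E u t : Q *m state A B (Y *m s) u t = state A' (Q *m B) s u t.
  elim: t => [|t IH]; first by rewrite /= mulmxA QY mul1mx.
  by rewrite /= mulmxDr !mulmxA AE -mulmxA IH.
apply: (ss_ext (sim_ss A B C D (Y *m s) (fun t => usubmx (w t)))) => t.
by rewrite [RHS]hs /sim {1}CE -mulmxA E.
Qed.

(** Controllability places [w2] after a zero past. The zero-state response of the smaller model to
    the same input also lies in the larger one, and the difference has zero input and [k] initial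
    zeros, so it vanishes. Thus [w2] is a shift of a trajectory of the smaller model. *)
Lemma controllable_min n (A : 'M[R]_n) (B : 'M[R]_(n, m)) (C : 'M[R]_(p, n))
  (D : 'M[R]_(p, m)) n0 (A0 : 'M[R]_n0) (B0 : 'M[R]_(n0, m)) (C0 : 'M[R]_(p, n0))
  (D0 : 'M[R]_(p, m)) k :
  is_lag C A k -> controllable (ss_behavior A B C D) ->
  (forall w, ss_behavior A0 B0 C0 D0 w -> ss_behavior A B C D w) ->
  forall w, ss_behavior A B C D w -> ss_behavior A0 B0 C0 D0 w.
Proof.
move=> lagk ctr sub w2 hw2.
have [w [t2 [hw [kt2 [w0 wt2]]]]] := ctr _ _ (ss0 A B C D) hw2 k.
pose u i := usubmx (w i); pose w' := sim A0 B0 C0 D0 0 u.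
have hw' : ss_behavior A0 B0 C0 D0 w' by exact: sim_ss.
have w'0 t : (t <= k)%N -> w' t = 0.
  move=> tk; rewrite /w' (@eq_sim _ _ _ _ _ _ _ _ _ u (fun=> 0)).
    by rewrite /sim state0 !mulmx0 addr0 col_mx0.
  by move=> i it; rewrite /u w0 ?linear0 // (leq_trans it).
have e t : - 1 *: w' t + w t = 0.
  move: t; apply: (lag_zero lagk (ss_lin (-1) (sub _ hw') hw)) => t.
    by rewrite linearP /= col_mxKu scaleN1r addNr.
  by move=> tk; rewrite w'0 ?w0 ?(ltnW tk) // scaler0 addr0.
apply: (ss_ext (ss_shift t2 hw')) => t.
have := e (t2 + t)%N; rewrite scaleN1r => /eqP; rewrite addrC subr_eq0 => /eqP <-.
by rewrite wt2 ?leq_addr // addKn.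
Qed.

Lemma hankel_window n (A : 'M[R]_n) (B : 'M[R]_(n, m)) (C : 'M[R]_(p, n))
  (D : 'M[R]_(p, m)) d T (wd : traj R m p) (v : 'cV[R]_(T - d.+1 + 1)) : (d < T)%N ->
  in_restr (ss_behavior A B C D) T wd ->
  exists w, ss_behavior A B C D w /\ hankel d.+1 T wd *m v = win w 0 d.+1.
Proof.
move=> dT [w [hw e]].
exists (fun t => \sum_j v j 0 *: w (j + t)%N); split.
  by apply: ss_sum => j; exact: ss_shift.
rewrite hankel_mul; apply: sel_inj => a ad; rewrite sel_win // mulmx_sumr.
apply: eq_bigr => j _; rewrite -scalemxAr sel_win // e //.
by have := ltn_ord j; lia.
Qed.

(** The Hankel columns are windows of the model and lie in the image of [param], whose source has
    dimension [nmin + m * d.+1]. When the rank attains this bound the two images coincide. *)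
Lemma hankel_full_rank nmin (A0 : 'M[R]_nmin) (B0 : 'M[R]_(nmin, m)) (C0 : 'M[R]_(p, nmin))
  (D0 : 'M[R]_(p, m)) d T (wd : traj R m p) : (d < T)%N ->
  in_restr (ss_behavior A0 B0 C0 D0) T wd ->
  (\rank (hankel d.+1 T wd) <= nmin + m * d.+1)%N /\
  (\rank (hankel d.+1 T wd) = (nmin + m * d.+1)%N ->
   forall w t, ss_behavior A0 B0 C0 D0 w ->
     exists v, win w t d.+1 = hankel d.+1 T wd *m v).
Proof.
move=> dT hB0; set H := hankel _ _ _.
have sub : (H^T <= (param A0 B0 C0 D0 d.+1)^T)%MS.
  apply: submx_ker => c hc; apply: trmx_inj; rewrite trmx0 trmx_mul trmxK.
  apply/rowP => j; rewrite [RHS]mxE -[LHS](_ : (c^T *m H *m delta_mx j (0 : 'I_1)) 0 0 = _); last first.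
    by rewrite -colE mxE.
  have [w [hw]] := hankel_window (delta_mx j 0) dT hB0.
  have [v ->] := win_param d.+1 0 hw; rewrite -mulmxA -/H => ->.
  rewrite mulmxA (_ : c^T *m _ = 0) ?mul0mx ?mxE //.
  by apply: trmx_inj; rewrite trmx_mul trmxK hc trmx0.
have ub : (\rank (param A0 B0 C0 D0 d.+1)^T <= nmin + m * d.+1)%N.
  by rewrite (mulnC m); exact: rank_leq_row.
rewrite -(mxrank_tr H); split; first exact: leq_trans (mxrankS sub) ub.
move=> rk w t hw; have [v ->] := win_param d.+1 t hw.
have /submxP [M ME] : ((param A0 B0 C0 D0 d.+1)^T <= H^T)%MS.
  by rewrite -(geq_leqif (mxrank_leqif_sup sub)) rk.
exists (M^T *m v); rewrite mulmxA; congr (_ *m _).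
by apply: trmx_inj; rewrite trmx_mul trmxK ME.
Qed.

Lemma Lcont_rep (Bh : behavior R m p) L : in_Lcont Bh L ->
  exists n (A : 'M[R]_n) (B : 'M[R]_(n, m)) (C : 'M[R]_(p, n)) (D : 'M[R]_(p, m)) k,
    [/\ is_ss_rep Bh A B C D, is_lag C A k, (k <= L)%N &
        controllable (ss_behavior A B C D)].
Proof.
move=> [_ [ctr [n [A [B [C [D [k [rep [lagk kL]]]]]]]]]].
exists n, A, B, C, D, k; split=> // w1 w2 /rep h1 /rep h2 t1.
by have [w [t2 [/rep hw h]]] := ctr _ _ h1 h2 t1; exists w, t2.
Qed.

Lemma restr_rep (Bh : behavior R m p) n (A : 'M[R]_n) (B : 'M[R]_(n, m))
  (C : 'M[R]_(p, n)) (D : 'M[R]_(p, m)) T wd :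
  is_ss_rep Bh A B C D -> in_restr Bh T wd -> in_restr (ss_behavior A B C D) T wd.
Proof. by move=> rep [w [/rep hw h]]; exists w. Qed.

Lemma windows_in_hankel (Bh : behavior R m p) L d T wd nmin : (L <= d)%N -> (d < T)%N ->
  is_nmin T wd nmin -> in_Lcont Bh L -> in_restr Bh T wd ->
  \rank (hankel d.+1 T wd) = (nmin + m * d.+1)%N ->
  forall w t, Bh w -> exists v, win w t d.+1 = hankel d.+1 T wd *m v.
Proof.
move=> Ld dT [[B0h [[_ restr0] [[A0 [B0 [C0 [D0 rep0]]]] _]]] _].
move=> /Lcont_rep [n [A [B [C [D [k [rep lagk kL ctr]]]]]]] restr rk w t /rep hw.
have r0 := restr_rep rep0 restr0; have r1 := restr_rep rep restr.
have [_ /(_ rk) win0] := hankel_full_rank dT r0.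
apply: (win0); apply: (controllable_min lagk ctr) hw => w' hw'.
apply: (ss_windows lagk (leq_trans kL Ld)) => t'.
have [v ->] := win0 w' t' hw'.
by have [w'' [h1 h2]] := hankel_window v dT r1; exists w''.
Qed.

Lemma min_dim_exists (Bh : behavior R m p) n (A : 'M[R]_n) (B : 'M[R]_(n, m))
  (C : 'M[R]_(p, n)) (D : 'M[R]_(p, m)) : is_ss_rep Bh A B C D ->
  exists k, is_state_dim Bh k /\ (k <= n)%N.
Proof.
move=> rep.
pose P k := exists (A : 'M[R]_k) (B : 'M[R]_(k, m)) (C : 'M[R]_(p, k)) (D : 'M[R]_(p, m)),
  is_ss_rep Bh A B C D.
have ex : exists k, `[< P k >] by exists n; apply/asboolP; exists A, B, C, D.
exists (ex_minn ex); case: ex_minnP => k /asboolP hk mink; split.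
  by split=> // n' A' B' C' D' rep'; apply: mink; apply/asboolP; exists A', B', C', D'.
by apply: mink; apply/asboolP; exists A, B, C, D.
Qed.

(** An observable reduction of dimension [r] has an injective [param], so the windows of [Bh] form a
    space of dimension [r + m * L.+1] inside the image of the Hankel matrix; and [nmin <= r] because
    [Bh] explains the data. *)
Lemma rank_ge_of_full (Bh : behavior R m p) L T wd nmin :
  is_nmin T wd nmin -> in_Lcont Bh L -> in_restr Bh T wd ->
  (forall w t, Bh w -> exists v, win w t L.+1 = hankel L.+1 T wd *m v) ->
  (nmin + m * L.+1 <= \rank (hankel L.+1 T wd))%N.
Proof.
move=> [_ minn] LBh restr full.
have [n [A [B [C [D [k [rep lagk kL _]]]]]]] := Lcont_rep LBh.
have [r [A' [B' [C' [obs eqr]]]]] := observable_reduction B D lagk.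
have rep' : is_ss_rep Bh A' B' C' D by move=> w; rewrite -eqr.
have [k' [dimk' k'r]] := min_dim_exists rep'.
have nr : (nmin <= r)%N.
  by apply: leq_trans k'r; apply: minn dimk'; split=> //; case: LBh.
apply: (@leq_trans (r + m * L.+1)); first by rewrite leq_add2r.
rewrite (mulnC m) -(@param_full _ _ _ _ A' B' C' D L.+1); last first.
  by move=> c hc; apply: obs => j jk; apply: hc; apply: leq_trans (leqW kL).
rewrite -mxrank_tr -[X in (_ <= X)%N]mxrank_tr; apply: mxrankS.
apply: submx_ker => c hc; apply: trmx_inj; rewrite trmx0 trmx_mul trmxK.
have hc' : c^T *m hankel L.+1 T wd = 0.
  by apply: trmx_inj; rewrite trmx_mul trmxK hc trmx0.
apply/rowP => j; rewrite [RHS]mxE -[LHS](_ : (c^T *m param A' B' C' D L.+1 *m delta_mx j (0 : 'I_1)) 0 0 = _); last first.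
  by rewrite -colE mxE.
have [s [u [-> _]]] := @param_surj R m r L.+1 (delta_mx j 0).
rewrite -mulmxA param_win.
have [v ->] := full _ 0%N (proj2 (rep' _) (sim_ss A' B' C' D s u)).
by rewrite mulmxA hc' mul0mx mxE.
Qed.
End Behaviors.

(** * Autoregressive models *)

(** The input of [w1] is kept through [t1], the state is then steered in [n] steps to the initial
    state of [w2], and the input of [w2] follows. *)
Lemma reach_controllable (R : realType) m p n (A1 : 'M[R]_n) (B1 : 'M[R]_(n, m)) (C1 : 'M[R]_(p, n))
  (D1 : 'M[R]_(p, m)) : reach A1 B1 -> controllable (ss_behavior A1 B1 C1 D1).
Proof.
move=> h w1 w2 /ss_sim [s1 e1] /ss_sim [s2 e2] t1.
pose u1 i := usubmx (w1 i); pose u2 i := usubmx (w2 i).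
have [v hv] := steer (state A1 B1 s1 u1 t1.+1) s2 h.
pose t2 := (t1.+1 + n)%N.
pose u i := if (i <= t1)%N then u1 i else if (i < t2)%N then v (i - t1.+1)%N else u2 (i - t2)%N.
have E1 : state A1 B1 s1 u t1.+1 = state A1 B1 s1 u1 t1.+1.
  by apply: eq_state => i; rewrite ltnS /u => ->.
have E2 : state A1 B1 s1 u t2 = s2.
  rewrite /t2 state_add E1 -hv; apply: eq_state => i il.
  by rewrite /u leqNgt leq_addr /= /t2 ltn_add2l il addKn.
exists (sim A1 B1 C1 D1 s1 u), t2; split; first exact: sim_ss.
split; first by rewrite /t2; lia.
split=> t ht.
  by rewrite e1; apply: eq_sim => i it; rewrite /u (leq_trans it ht).
rewrite e2 -[in LHS](subnKC ht) /sim state_add E2.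
have uE i : u (t2 + i)%N = u2 i.
  by rewrite /u ltnNge leq_addr addKn /= ifF // /t2; lia.
by rewrite uE; congr (col_mx _ (_ *m _ + _)); apply: eq_state => i _; rewrite uE.
Qed.

Section ARX.
Variables (R : realType) (m p L : nat).
Local Notation q := (m + p)%N.
Implicit Types w : traj R m p.

(* Realization of y(t) = Y w_[t-L,t-1] + D u(t) whose state is the past window
   w_[t-L,t-1] itself.  It is not minimal, but reachability supplies the past that a
   trajectory on Z_+ of the recursion lacks. *)
Definition arxE : 'M[R]_(L * q, p) := rsubmx (wlast R m p L).
Definition arxA (Y : 'M[R]_(p, L * q)) := wshift R m p L + arxE *m Y.
Definition arxB (D : 'M[R]_(p, m)) := lsubmx (wlast R m p L) + arxE *m D.

(** Shifting an arbitrary sample into the window is a step of the model with the equation error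
    entering through [arxE] as a second input. *)
Lemma arx_input Y D (x : 'cV[R]_(L * q)) (v : 'cV[R]_q) :
  arxA Y *m x + arxB D *m usubmx v + arxE *m (dsubmx v - (Y *m x + D *m usubmx v)) =
  wshift R m p L *m x + wlast R m p L *m v.
Proof.
rewrite -[in RHS](hsubmxK (wlast R m p L)) -[X in _ = _ + _ *m X](vsubmxK v) mul_row_col.
rewrite /arxA /arxB -/arxE !mulmxDl mulmxBr mulmxDr -!mulmxA.
set a := wshift _ _ _ _ *m _; set b := arxE *m (Y *m x); set c := lsubmx _ *m _.
set d := arxE *m (D *m _); set e := arxE *m _.
by move: a b c d e => a b c d e; apply/colP => i; rewrite !mxE; ring.
Qed.

Section Fixed.
Variables (Y : 'M[R]_(p, L * q)) (D : 'M[R]_(p, m)).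
Local Notation A := (arxA Y).
Local Notation B := (arxB D).
Local Notation beh := (ss_behavior A B Y D).

Definition arx_at w t :=
  dsubmx (w (t + L)%N) = Y *m win w t L + D *m usubmx (w (t + L)%N).

Lemma arx_step w t : arx_at w t -> win w t.+1 L = A *m win w t L + B *m usubmx (w (t + L)%N).
Proof. by move=> h; rewrite win_next -(arx_input Y D) -h subrr mulmx0 addr0. Qed.

Lemma arx_win w K : (forall t, (t < K)%N -> arx_at w t) -> forall i, (i <= K)%N ->
  win w i L = state A B (win w 0 L) (fun j => usubmx (w (j + L)%N)) i.
Proof.
move=> h; elim=> // i IH iK.
by rewrite arx_step ?IH // ?(ltnW iK) //; exact: h.
Qed.

(** The initial state, read as a window, is prepended to the simulated trajectory; after [L] steps
    it has been shifted out entirely. *)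
Lemma arx_state_window s u : state A B s u L = win (sim A B Y D s u) 0 L.
Proof.
have [g [gs _]] := unwin s.
pose h i := if (i < L)%N then g i else sim A B Y D s u (i - L)%N.
have h0 : win h 0 L = s.
  by rewrite -gs; apply: eq_win => a aL; rewrite /h add0n aL.
have hL i : h (i + L)%N = sim A B Y D s u i by rewrite /h ltnNge leq_addl addnK.
have E i : win h i L = state A B s u i.
  elim: i => [|i IH] //=.
  by rewrite arx_step /arx_at hL ?col_mxKu IH // col_mxKd.
by rewrite -E; apply: eq_win => a _; rewrite (addnC L a) hL.
Qed.

(** With zero input, [L] zero outputs make the state after [L] steps a zero window, so all later
    outputs vanish and the rank of the observability matrix is stationary at [L]. *)
Lemma arx_lag : exists2 k, is_lag Y A k & (k <= L)%N.
Proof.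
have rkL : \rank (obsv L Y A) = \rank (obsv L.+1 Y A).
  apply/eqP; rewrite eqn_leq; apply/andP; split; apply: mxrankS; apply: submx_ker => c.
    rewrite !obsv_stack => h; apply: sel_inj => j jL; rewrite sel_stack // mulmx0.
    by rewrite -(sel_stack (fun j => Y *m A ^+ j *m c) (leqW jL)) h mulmx0.
  rewrite !obsv_stack => h.
  have y0 j : (j < L)%N -> Y *m A ^+ j *m c = 0.
    by move=> jL; rewrite -(sel_stack (fun j => Y *m A ^+ j *m c) jL) h mulmx0.
  have AL : A ^+ L *m c = 0.
    rewrite -(state0 A B) arx_state_window.
    apply: sel_inj => a aL; rewrite sel_win // mulmx0 add0n /sim state0 !mulmx0 addr0.
    by rewrite mulmxA y0 // col_mx0.
  apply: sel_inj => j; rewrite ltnS leq_eqVlt => /orP[/eqP ->|jL].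
    by rewrite sel_stack // mulmx0 -mulmxA AL mulmx0.
  by rewrite sel_stack ?leqW // y0 // mulmx0.
have ex : exists k, \rank (obsv k Y A) == \rank (obsv k.+1 Y A) by exists L; rewrite rkL.
exists (ex_minn ex); case: ex_minnP => k /eqP hk mink; last by apply: mink; rewrite rkL.
split=> // k' k'k /eqP h; have := mink _ h; by rewrite leqNgt k'k.
Qed.

Hypothesis AB : reach A B.

Lemma arx_Lcont : in_Lcont beh L.
Proof.
have rep : is_ss_rep beh A B Y D by [].
split; first by exists _, A, B, Y, D.
split; first exact: reach_controllable.
by have [k lagk kL] := arx_lag; exists _, A, B, Y, D, k.
Qed.

Lemma arx_explains (wd : traj R m p) K : (0 < q)%N ->
  (forall t, (t < K)%N -> arx_at wd t) -> in_restr beh (K + L)%N wd.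
Proof.
move=> q0 hK.
have Ln : (L <= L * q)%N by rewrite leq_pmulr.
have [u1 hu1] := steer 0 (win wd 0 L) AB.
pose n := (L * q)%N.
(* The first [n] inputs steer from zero to the first data window, which thus occupies the times from
   [n - L] to [n - 1]; dropping the first [n - L] samples aligns the trajectory with the data. *)
pose u i := if (i < n)%N then u1 i else usubmx (wd (i - n + L)%N).
pose w0 := sim A B Y D 0 u.
have sn : state A B 0 u n = win wd 0 L.
  by rewrite -hu1; apply: eq_state => i; rewrite /u => ->.
have shift k i : w0 (k + i)%N = sim A B Y D (state A B 0 u k) (fun j => u (k + j)%N) i.
  by rewrite /w0 /sim state_add.
have past : win w0 (n - L) L = win wd 0 L.
  rewrite -sn; have <- : state A B 0 u (n - L + L) = state A B 0 u n by rewrite subnK.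
  rewrite state_add arx_state_window.
  by apply: eq_win => a _; rewrite shift add0n.
exists (fun t => w0 (n - L + t)%N); split; first exact: ss_shift (sim_ss _ _ _ _ _ _).
move=> t tK; case: (ltnP t L) => [tL|Lt].
  by rewrite (win_inj past tL) add0n.
have -> : (n - L + t)%N = (n + (t - L))%N by lia.
have tK' : (t - L < K)%N by lia.
have uE j : u (n + j)%N = usubmx (wd (j + L)%N) by rewrite /u ltnNge leq_addr addKn.
rewrite shift sn /sim uE.
have -> : state A B (win wd 0 L) (fun j => u (n + j)%N) (t - L) = win wd (t - L) L.
  by rewrite (arx_win hK (ltnW tK')); apply: eq_state => i _.
by rewrite -(hK _ tK') subnK // vsubmxK.
Qed.
End Fixed.
End ARX.

(** * Necessity *)

Section Necessity.
Variables (R : realType) (m p L : nat).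
Local Notation q := (m + p)%N.
Implicit Types w : traj R m p.

(** With inputs and equation errors both free, any window [x] can follow [L] zero samples, so every
    state is reached from zero. *)
Lemma arx_joint_reach (Y : 'M[R]_(p, L * q)) (D : 'M[R]_(p, m)) (xi : 'rV[R]_(L * q)) :
  unreach (arxA Y) (arxB L D) xi -> unreach (arxA Y) (arxE R m p L) xi -> xi = 0.
Proof.
move=> hB hE; suff h (x : 'cV[R]_(L * q)) : xi *m x = 0.
  by rewrite -(mulmx1 xi); apply/rowP => j; have /colP/(_ 0) := h (col j 1%:M);
    rewrite colE mulmxA -colE !mxE.
have [g [gx _]] := unwin x.
pose h i := if (i < L)%N then 0 else g (i - L)%N.
have h0 : win h 0 L = 0.
  by apply: sel_inj => a aL; rewrite sel_win // mulmx0 /h add0n aL.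
have E i (z : 'rV[R]_(L * q)) : unreach (arxA Y) (arxB L D) z ->
    unreach (arxA Y) (arxE R m p L) z -> z *m win h i L = 0.
  elim: i z => [|i IH] z zB zE; first by rewrite h0 mulmx0.
  rewrite win_next -(arx_input Y D) !mulmxDr !mulmxA (unreach0 zB) (unreach0 zE).
  by rewrite !mul0mx !addr0; apply: IH; exact: unreach_step.
rewrite -gx -(E L xi) //; congr (_ *m _); apply: eq_win => a _.
by rewrite /h ltnNge leq_addr addKn.
Qed.

Lemma quad_neg_open n (M : 'M[R]_n) (x z : 'cV[R]_n) : (x^T *m M *m x) 0 0 < 0 ->
  exists2 e : R, 0 < e & forall s, 0 < s -> s < e ->
    ((x + s *: z)^T *m M *m (x + s *: z)) 0 0 < 0.
Proof.
move=> h.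
set a := (x^T *m M *m x) 0 0 in h.
pose b := (x^T *m M *m z) 0 0 + (z^T *m M *m x) 0 0; pose c := (z^T *m M *m z) 0 0.
have E s : ((x + s *: z)^T *m M *m (x + s *: z)) 0 0 = a + s * b + s ^+ 2 * c.
  have -> : (x + s *: z)^T = x^T + s *: z^T by apply/rowP => i; rewrite !mxE.
  rewrite !mulmxDl !mulmxDr -!scalemxAr -!scalemxAl.
  have mD (X Y : 'M[R]_1) : (X + Y) 0 0 = X 0 0 + Y 0 0 by rewrite mxE.
  have mZ (k : R) (X : 'M[R]_1) : (k *: X) 0 0 = k * X 0 0 by rewrite mxE.
  by rewrite !mD !mZ /a /b /c; ring.
have B0 : 0 < `|b| + `|c| + 1 by have := normr_ge0 b; have := normr_ge0 c; lra.
exists (Num.min 1 (- a / (`|b| + `|c| + 1))).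
  by rewrite lt_min ltr01 divr_gt0 // oppr_gt0.
move=> s s0; rewrite lt_min => /andP[s1]; rewrite ltr_pdivlMr // => hs.
rewrite E.
have hb : s * b <= s * `|b| by rewrite ler_pM2l // ler_norm.
have hc : s ^+ 2 * c <= s * `|c|.
  apply: (@le_trans _ _ (s ^+ 2 * `|c|)); first by rewrite ler_pM2l ?ler_norm // exprn_gt0.
  by apply: ler_wpM2r => //; rewrite expr2 ger_pMl // ltW.
nra.
Qed.

Variables (n : nat) (A : 'M[R]_n) (B : 'M[R]_(n, m)) (C : 'M[R]_(p, n)) (D : 'M[R]_(p, m)).
Local Notation Bs := (ss_behavior A B C D).
Variables (Y0 : 'M[R]_(p, L * q)) (D0 : 'M[R]_(p, m)).
Hypothesis arx0 : forall w t, Bs w -> arx_at Y0 D0 w t.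
Hypothesis ctr : controllable Bs.

(** By controllability each window of the behavior also occurs after a zero past, hence as a state
    reached from zero in the autoregressive model. *)
Lemma windows_reachable (xi : 'rV[R]_(L * q)) w t : Bs w ->
  unreach (arxA Y0) (arxB L D0) xi -> xi *m win w t L = 0.
Proof.
move=> hw hxi.
have [w' [t2 [hw' [_ [w'0 w'2]]]]] := ctr (ss0 A B C D) (ss_shift t hw) L.
have -> : win w t L = win w' t2 L.
  by apply: eq_win => a _; rewrite w'2 ?leq_addr // addKn.
rewrite (arx_win (K := t2) (Y := Y0) (D := D0)) // => [|i _]; last exact: arx0.
have -> : win w' 0 L = 0.
  by apply: sel_inj => a aL; rewrite sel_win // mulmx0 w'0 // add0n ltnW.
exact: unreach_state.
Qed.

(** The row [al], [be] is not identically zero on the behavior, so [perturb_reach] applies. Its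
    feedback [K] vanishes on windows of the behavior, and its rank-one term vanishes wherever the
    functional does, so the model equation survives there. *)
Lemma reachable_model (al : 'rV[R]_(L * q)) (be : 'rV[R]_m) w0 t0 : Bs w0 ->
  al *m win w0 t0 L + be *m usubmx (w0 (t0 + L)%N) != 0 ->
  exists (Y : 'M[R]_(p, L * q)) (D1 : 'M[R]_(p, m)),
    reach (arxA Y) (arxB L D1) /\
    forall w t, Bs w -> al *m win w t L + be *m usubmx (w (t + L)%N) = 0 ->
      arx_at Y D1 w t.
Proof.
move=> hw0 h0.
have hr : ~ (be = 0 /\ unreach (arxA Y0) (arxB L D0) al).
  move=> [be0 hal]; move/eqP: h0; apply.
  by rewrite be0 mul0mx addr0 windows_reachable.
have [K [eta [hK hreach]]] := perturb_reach (@arx_joint_reach Y0 D0) hr.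
exists (Y0 + K + eta *m al), (D0 + eta *m be); split.
  move: hreach; congr reach; rewrite ?/arxA ?/arxB !mulmxDr ?mulmxA ?addrA //.
move=> w t hw r0; rewrite /arx_at (arx0 t hw) !mulmxDl.
have -> : K *m win w t L = 0.
  apply/row_matrixP => i; rewrite row_mul row0; apply: windows_reachable => // j.
  by rewrite -!row_mul hK row0.
have : eta *m (al *m win w t L + be *m usubmx (w (t + L)%N)) = 0 by rewrite r0 mulmx0.
rewrite mulmxDr !mulmxA addr0 => e.
by rewrite addrACA e addr0.
Qed.

Lemma informative_windows T (wd : traj R m p) (M : 'M[R]_(L.+1 * q))
  (x0 : 'cV[R]_(L.+1 * q)) :
  (0 < q)%N -> (L < T)%N -> in_restr Bs T wd ->
  (x0^T *m M *m x0) 0 0 < 0 ->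
  (forall Bh : behavior R m p, in_Sigma T wd Bh -> in_Lcont Bh L ->
     forall w, Bh w -> 0 <= ((win w 0 L.+1)^T *m M *m win w 0 L.+1) 0 0) ->
  forall w t, Bs w -> exists v, win w t L.+1 = hankel L.+1 T wd *m v.
Proof.
move=> q0 LT restr hx0 hinf ws ts hws.
set H := hankel _ _ _.
apply: contrapT => hno.
have [rho rhoH rhow] : exists2 rho : 'rV[R]_(L.+1 * q), rho *m H = 0 &
    rho *m win ws ts L.+1 != 0.
  apply: contrapT => hn; apply: hno.
  have /submxP [V VE] : ((win ws ts L.+1)^T <= H^T)%MS.
    apply: submx_ker => c hc; apply: trmx_inj; rewrite trmx0 trmx_mul trmxK.
    apply/eqP; apply: contraT => hne; case: hn; exists c^T => //.
    by apply: trmx_inj; rewrite trmx_mul trmxK hc trmx0.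
  by exists V^T; apply: trmx_inj; rewrite VE trmx_mul trmxK.
have usubP (x y : 'cV[R]_q) s : usubmx (x + s *: y) = usubmx x + s *: usubmx y.
  by apply/colP => i; rewrite !mxE.
have dsubP (x y : 'cV[R]_q) s : dsubmx (x + s *: y) = dsubmx x + s *: dsubmx y.
  by apply/colP => i; rewrite !mxE.
have rhoE w t := win_split rho w t.
set rho1 := \sum_(a < L) _ in rhoE; set rho2 := rho *m _ in rhoE.
(* The current output is eliminated from [rho] by the model equation, leaving a functional of the
   past window and the current input. *)
have [al alE] : exists al, al = rho1 + rsubmx rho2 *m Y0 by eexists.
have [be beE] : exists be, be = lsubmx rho2 + rsubmx rho2 *m D0 by eexists.
pose r0 w t := al *m win w t L + be *m usubmx (w (t + L)%N).
have r0E w t : arx_at Y0 D0 w t -> r0 w t = rho *m win w t L.+1.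
  move=> h; rewrite rhoE -[in RHS](hsubmxK rho2) -[in RHS](vsubmxK (w (t + L)%N)).
  rewrite mul_row_col h /r0 alE beE !mulmxDl mulmxDr !mulmxA.
  by rewrite -[LHS]addrA [X in _ = _ + X]addrCA.
have [wB [hwB eB]] := restr.
have r0d t : (t < T - L)%N -> r0 wB t = 0.
  move=> tT; rewrite r0E; last exact: arx0.
  have jT : (t < T - L.+1 + 1)%N by lia.
  have -> : win wB t L.+1 = H *m delta_mx (Ordinal jT) 0.
    rewrite hankel_mul (bigD1 (Ordinal jT)) //= big1 => [|j jn].
      rewrite mxE !eqxx scale1r addr0; apply: eq_win => a aL.
      by apply: eB; lia.
    by rewrite mxE (negPf jn) scale0r.
  by rewrite mulmxA rhoH mul0mx.
have r0s : r0 ws ts != 0 by rewrite r0E //; exact: arx0.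
have [Y [D1 [hreach hmodel]]] := reachable_model hws r0s.
have [wc [wcx _]] := unwin x0.
pose ws' i := ws (ts + i)%N.
have win_ws' N : win ws' 0 N = win ws ts N by apply: eq_win => a _; rewrite /ws' add0n.
have r0ws' : r0 ws' 0%N = r0 ws ts by rewrite /r0 win_ws' /ws' add0n.
have r0lin s w w' : r0 (fun i => w i + s *: w' i) 0%N = r0 w 0%N + s *: r0 w' 0%N.
  rewrite /r0 (winD w (fun i => s *: w' i)) winZ usubP !mulmxDr -!scalemxAr.
  by rewrite scalerDr addrACA.
(* A small move from [x0] towards the window of [ws] makes [r0] nonzero while the quadratic form
   stays negative. *)
have [w1 [hw1 r1]] : exists w1, ((win w1 0 L.+1)^T *m M *m win w1 0 L.+1) 0 0 < 0 /\
    r0 w1 0%N 0 0 != 0.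
  rewrite -wcx in hx0.
  have [e e0 he] := quad_neg_open (win ws' 0 L.+1) hx0.
  pose g : {poly R} := (r0 wc 0%N 0 0)%:P + (r0 ws' 0%N 0 0) *: 'X.
  have g0 : g != 0.
    apply/eqP => /polyP /(_ 1%N); rewrite coefD coefC coefZ coefX /= add0r mulr1 coef0.
    move=> e'; move/eqP: r0s; apply; rewrite -r0ws' (mx11_scalar (r0 ws' 0%N)) e'.
    by apply/matrixP => i j; rewrite !mxE mul0rn.
  have [s [s0 se gs]] := poly_nonroot g0 e0.
  exists (fun i => wc i + s *: ws' i); split.
    by rewrite (winD wc (fun i => s *: ws' i)) winZ; exact: he.
  by rewrite r0lin mxE [X in _ + X]mxE; move: gs; rewrite !hornerE mulrC.
(* [c] is the equation error of [w1] in the reachable model. With [eta = c / r0(w1)], the model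
   [Ys s], [Ds s] fits [w1] exactly at [s = 1]; for other [s] the remaining error [(1 - s) c] is
   absorbed into the last output through [z]. *)
pose c := dsubmx (w1 L) - (Y *m win w1 0 L + D1 *m usubmx (w1 L)).
pose z i : 'cV[R]_q := if i == L then col_mx 0 (- c) else 0.
have [e e0 he] := quad_neg_open (win z 0 L.+1) hw1.
have [eta etaE] : exists eta, eta = (r0 w1 0%N 0 0)^-1 *: c by eexists.
pose Ys s := Y + s *: (eta *m al); pose Ds s := D1 + s *: (eta *m be).
have etar w t s : Ys s *m win w t L + Ds s *m usubmx (w (t + L)%N) =
    Y *m win w t L + D1 *m usubmx (w (t + L)%N) + s *: (eta *m r0 w t).
  by rewrite /r0 mulmxDr scalerDr !mulmxA /Ys /Ds !mulmxDl -!scalemxAl [LHS]addrACA.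
(* The model is reachable at [s = 0], hence for some [s] below and arbitrarily close to [1]. *)
have [g [g0 hg]] := reach_open (arxE R m p L *m (eta *m al)) 0 (arxE R m p L *m (eta *m be)) hreach.
have lt1 : 1 - Num.min e 1 < 1 by rewrite gtrBl lt_min e0 ltr01.
have [s [s1 s2 /hg hs]] := poly_nonroot g0 lt1.
have hreachs : reach (arxA (Ys s)) (arxB L (Ds s)).
  by move: hs; rewrite scaler0 addr0 /arxA /arxB /Ys /Ds !mulmxDr -!scalemxAr !addrA.
have es : 1 - s < e.
  have : Num.min e 1 <= e by rewrite ge_min lexx.
  by lra.
have es0 : 0 < 1 - s by rewrite subr_gt0.
pose w2 i := w1 i + (1 - s) *: z i.
have w2past : win w2 0 L = win w1 0 L.
  by apply: eq_win => a aL; rewrite /w2 /z add0n ltn_eqF //= scaler0 addr0.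
have w2u : usubmx (w2 L) = usubmx (w1 L).
  by rewrite /w2 /z eqxx usubP col_mxKu scaler0 addr0.
have w2arx : arx_at (Ys s) (Ds s) w2 0.
  rewrite /arx_at etar add0n w2past w2u.
  have -> : r0 w2 0%N = r0 w1 0%N by rewrite /r0 add0n w2past w2u.
  rewrite (mx11_scalar (r0 w1 0%N)) mul_mx_scalar etaE (scalerA (r0 w1 0%N 0 0)) divff // scale1r.
  rewrite {1}/w2 /z eqxx dsubP col_mxKd scalerN scalerBl scale1r.
  by rewrite opprB [LHS]addrCA [LHS]addrC; congr (_ + _); rewrite /c subKr.
have [w3 [hw3 e3]] : in_restr (ss_behavior (arxA (Ys s)) (arxB L (Ds s)) (Ys s) (Ds s)) (1 + L) w2.
  by apply: arx_explains => // t; rewrite ltnS leqn0 => /eqP ->.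
have win3 : win w3 0 L.+1 = win w1 0 L.+1 + (1 - s) *: win z 0 L.+1.
  rewrite -winZ -(winD w1 (fun i => (1 - s) *: z i)); apply: eq_win => a aL.
  by rewrite add0n e3.
have := he _ es0 es; rewrite -win3 ltNge => /negP; apply.
apply: (hinf _ _ (arx_Lcont hreachs) _ hw3).
split; first by exists _, (arxA (Ys s)), (arxB L (Ds s)), (Ys s), (Ds s).
have : in_restr (ss_behavior (arxA (Ys s)) (arxB L (Ds s)) (Ys s) (Ds s)) (T - L + L) wB.
  apply: arx_explains => // t tT.
  have rt := r0d _ tT; rewrite /arx_at etar rt mulmx0 scaler0 addr0.
  exact: hmodel.
rewrite subnK ?(ltnW LT) // => -[w4 [h4 e4]]; exists w4; split=> // t tT.
by rewrite e4 // eB.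
Qed.
End Necessity.

(** * Negative directions of the supply rate and assembly of the two parts *)

Lemma inertia_neg (R : realType) n (M : 'M[R]_n) a b c : (0 < a)%N ->
  has_inertia M a b c -> exists v : 'cV[R]_n, (v^T *m M *m v) 0 0 < 0.
Proof.
move=> a0 [lam [chE [ha _]]].
have [i] : exists i, i \in [set i | lam i < 0] by apply/card_gt0P; rewrite ha.
rewrite inE => li.
have /eigenvalueP [v vE v0] : eigenvalue M (lam i).
  rewrite eigenvalue_root_char chE /root horner_prod (bigD1 i) //=.
  by rewrite !hornerE subrr mul0r.
exists v^T; rewrite trmxK vE -scalemxAl mxE pmulr_llt0 //.
rewrite lt_def row_dot_ge0 andbT; apply/eqP => /row_dot_eq0 e.
by rewrite e eqxx in v0.
Qed.

Lemma lmi_sym (R : realType) m p N d (Phi : 'M[R]_(N * (m + p))) (Psi : 'M[R]_(d * (m + p))) :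
  sym_mx Phi -> sym_mx Psi -> sym_mx (lmi_mx Phi Psi).
Proof.
rewrite /sym_mx /lmi_mx => hPhi hPsi.
have E n K off (M : 'M[R]_n) : M^T = M ->
    ((placed R n K off)^T *m M *m placed R n K off)^T =
    (placed R n K off)^T *m M *m placed R n K off.
  by move=> h; rewrite !trmx_mul trmxK h mulmxA.
have D n (M1 M2 : 'M[R]_n) : (M1 + M2)^T = M1^T + M2^T by apply/matrixP => i j; rewrite !mxE.
have O n (M1 : 'M[R]_n) : (- M1)^T = - M1^T by apply/matrixP => i j; rewrite !mxE.
by rewrite !D O !padTL_placed padBR_placed !E.
Qed.

Lemma psd_lmi_window (R : realType) m p N d T (wd : traj R m p) (Phi : 'M[R]_(N * (m + p)))
  (Psi : 'M[R]_(d * (m + p))) w t v : (N <= d.+1)%N ->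
  psd ((hankel d.+1 T wd)^T *m lmi_mx Phi Psi *m hankel d.+1 T wd) ->
  win w t d.+1 = hankel d.+1 T wd *m v -> qdf (nabla Psi) w t <= qdf Phi w t.
Proof.
move=> Nd [_ /(_ v)]; rewrite quad_mul => h wE.
by rewrite -subr_ge0 -lmi_win // wE.
Qed.

(** The equation [d = L] is a separate hypothesis because matrix sizes depend on [d], and [dmax 1 L]
    equals [L] only propositionally. *)
Lemma static_necessity (R : realType) m p L d T (wd : traj R m p)
  (Phi : 'M[R]_(1 * (m + p))) (Bstar : behavior R m p) nmin :
  d = L -> (0 < m + p)%N -> sym_mx Phi ->
  (exists v : 'cV[R]_(1 * (m + p)), (v^T *m Phi *m v) 0 0 < 0) ->
  in_Lcont Bstar L -> in_restr Bstar T wd -> (d < T)%N -> is_nmin T wd nmin ->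
  (exists Psi : 'M[R]_(d * (m + p)), psd Psi /\
    forall Bh, in_Sigma T wd Bh -> in_Lcont Bh L -> qdf_le_on Bh (nabla Psi) Phi) ->
  \rank (hankel d.+1 T wd) = (nmin + m * L.+1)%N /\
  exists Psi : 'M[R]_(d * (m + p)),
    psd Psi /\ psd ((hankel d.+1 T wd)^T *m lmi_mx Phi Psi *m hankel d.+1 T wd).
Proof.
move=> -> q0 symPhi [v hv] LB restr LT minn [Psi [psdPsi hPsi]].
have [n [A [B [C [D [k [rep lagk kL ctr]]]]]]] := Lcont_rep LB.
have restrB := restr_rep rep restr.
have [Y0 [D0 arx0]] := arx_of_lag B D lagk kL.
have SB : in_Sigma T wd Bstar by split=> //; case: LB.
(* On a constant trajectory the storage terms cancel. *)
have neg : exists x : 'cV[R]_(L.+1 * (m + p)), (x^T *m lmi_mx Phi Psi *m x) 0 0 < 0.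
  have [w [wv _]] := unwin v.
  pose w' : traj R m p := fun=> w 0%N.
  have wv' : win w' 0 1 = v by rewrite -wv; apply: eq_win => -[].
  have w1 : win w' 1 L = win w' 0 L by exact: eq_win.
  exists (win w' 0 L.+1); rewrite lmi_win // qdf_nabla /qdf w1 subrr subr0.
  by rewrite wv'.
have [x hx] := neg.
have full w t : Bstar w -> exists v, win w t L.+1 = hankel L.+1 T wd *m v.
  move=> /rep; apply: (informative_windows (fun w t => arx0 w t) ctr q0 LT restrB hx).
  move=> Bh SBh LBh w' hw'; rewrite lmi_win // subr_ge0.
  exact: (hPsi _ SBh LBh w' 0%N hw').
split.
  apply/eqP; rewrite eqn_leq (rank_ge_of_full minn LB restr full) andbT.
  have [[B0h [[_ restr0] [[A0 [B0 [C0 [D0' rep0]]]] _]]] _] := minn.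
  exact: (hankel_full_rank LT (restr_rep rep0 restr0)).1.
exists Psi; split=> //; split.
  by rewrite /sym_mx !trmx_mul trmxK (lmi_sym symPhi psdPsi.1) mulmxA.
move=> z; rewrite quad_mul.
have [w [/rep hw ->]] := hankel_window z LT restrB.
by rewrite lmi_win // subr_ge0; exact: (hPsi _ SB LB w 0%N hw).
Qed.

Theorem theorem3 (R : realType) (m p L N T : nat)
  (Phi : 'M[R]_(N * (m + p))) (Bstar : behavior R m p) (wd : traj R m p)
  (nmin : nat) :
  (1 <= m)%N -> (1 <= p)%N ->
  sym_mx Phi -> qdf_minimal Phi ->
  in_Lcont Bstar L -> in_restr Bstar T wd ->
  ((dmax N L).+1 <= T)%N ->
  is_nmin T wd nmin ->
  let d := dmax N L in
  let H := hankel d.+1 T wd in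
  (* (i) *)
  (forall Psi : 'M[R]_(d * (m + p)),
      \rank H = (nmin + m * d.+1)%N ->
      psd Psi -> psd (H^T *m lmi_mx Phi Psi *m H) ->
      informative L T wd Phi /\ storage_function Bstar Phi Psi)
  /\
  (* (ii) *)
  (N = 1%N -> has_inertia Phi p 0 m -> psd (- blk22 Phi) ->
     (informative L T wd Phi <->
      (\rank H = (nmin + m * L.+1)%N /\
       exists Psi : 'M[R]_(d * (m + p)),
         psd Psi /\ psd (H^T *m lmi_mx Phi Psi *m H)))).
Proof.
move=> m0 p0 symPhi _ LB restr dT minn d H.
have Ld : (L <= d)%N by rewrite leq_maxr.
(* [N] counts blocks, one more than the degree, and [N = 0] stands for degree [-1]. *)
have Nd : (N <= d.+1)%N by rewrite (leq_trans (leqSpred N)) // ltnS leq_maxl.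
have SB : in_Sigma T wd Bstar by split=> //; case: LB.
have part1 (Psi : 'M[R]_(d * (m + p))) : \rank H = (nmin + m * d.+1)%N ->
    psd Psi -> psd (H^T *m lmi_mx Phi Psi *m H) ->
    informative L T wd Phi /\ storage_function Bstar Phi Psi.
  move=> rk psdPsi psdH.
  have le Bh : in_Sigma T wd Bh -> in_Lcont Bh L -> qdf_le_on Bh (nabla Psi) Phi.
    move=> [_ restrh] LBh w t hw.
    have [v wE] := windows_in_hankel Ld dT minn LBh restrh rk t hw.
    exact: psd_lmi_window wE.
  split; first by exists Psi.
  by split; [move=> w t _; exact: psdPsi.2|exact: le].
split=> // N1; subst N => inert _.
have dL : d = L by rewrite /d /dmax max0n.
split=> [|[rk [Psi [h1 h2]]]]; last by case: (part1 Psi); rewrite ?dL // rk dL.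
apply: (static_necessity dL _ symPhi (inertia_neg p0 inert) LB restr dT minn).
by rewrite addn_gt0 m0.
Qed.
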